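(* Let $p\ge1$, let $W^N=X/N^{(p-1)/2}$ where $X$ is the real Gaussian symmetric random tensor of order $p$ and dimension $N$ described in the context, let $\mathcal A_0^N=(A_i^N)_{i\in\mathcal I_0}$, $A_i^N\in\mathcal E^N_{\ell_0(i)}$, be a finite deterministic collection of tensors stable under entrywise complex conjugation (with $\mathcal I_0,\ell_0$ not depending on $N$) satisfying (A1): for every $\mathfrak n\in\mathcal M_0(\mathcal I_0)$, $\sup_N|\mathfrak n(\mathcal A_0^N)|<\infty$. Let $\mathcal I=\mathcal I_0\sqcup\{\mathbf s\}$, $\ell=\ell_0$ on $\mathcal I_0$, $\ell(\mathbf s)=p$, $A^N_{\mathbf s}=W^N$, $\mathcal A^N=(A^N_i)_{i\in\mathcal I}$ and $\mathbb E_N[\mathfrak n]=\mathbb E[\mathfrak n(\mathcal A^N)]$. Then for any connected $\mathcal I$-map $\mathfrak m\in\mathcal M_p(\mathcal I)$, as $N\to\infty$, $$\mathbb E_N[\mathfrak m^{+\mathbf s}]=\frac1{(p-1)!}\sum_{v,\sigma}\mathbb E_N\big[(\mathfrak m.\sigma)^{\backslash v}\big]+O\Big(\frac1N\Big),$$ where the sum is over all $v\in V(\mathfrak m)$ such that $w_v=\mathbf s$ and all permutations $\sigma\in\mathrm S_p$ such that $(\mathfrak m.\sigma)^{\backslash v}$ has $p$ connected components (this sum might be empty).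
   Context: Gaussian symmetric tensor. For $i,j\in[N]^p$ write $i\sim j$ if $i$ is obtained from $j$ by permuting its $p$ coordinates; $\mathcal P_i$ is the cardinality of the class of $i$. $X=(X_i)_{i\in[N]^p}$ is real, $X_i=X_j$ if $i\sim j$, the $X_i$ for distinct classes are independent centered Gaussian variables with $\mathbb E X_i^2=p/\mathcal P_i$. Maps. $[n]=\{1,\dots,n\}$. A (combinatorial) map is a pair $\mathfrak m=(\pi,\alpha)$ of permutations of a set $\vec E(\mathfrak m)=[m]$ of half-edges, $\alpha$ an involution ($\alpha^2=\mathrm{id}$, fixed points allowed). The cycles of $\pi$ are the vertices, forming $V(\mathfrak m)$ and ordered by least element; $\partial v$ is the cycle of $v$ started at its least element (the half-edges attached to $v$), and $\deg(v)$ its length. Fixed points of $\alpha$ are the boundary edges, which are ordered (by default lexicographically); the 2-cycles of $\alpha$ are the edges. $E(\mathfrak m)$ is the set of all cycles of $\alpha$. $\mathcal M_q$ is the set of maps with $q$ boundary edges; $\gamma(\mathfrak m)$ is the number of connected components. An $I$-map (for an index set $I$ with order function $\ell$) is a map with labels $w_v\in I$, $\ell(w_v)=\deg(v)$; $\mathcal M_q(I)$ is the set of $I$-maps with $q$ boundary edges. Trace action. $\mathcal E^N_p=(\mathbb C^N)^{\otimes p}$, $\mathcal E_0^N=\mathbb C$. For an $I$-map $\mathfrak m\in\mathcal M_q(I)$ with boundary edges $\partial$ and a family $\mathcal A^N=(A_i^N)_{i\in I}$, $A_i^N\in\mathcal E^N_{\ell(i)}$, $\mathfrak m(\mathcal A^N)\in\mathcal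 E^N_q$ is $\mathfrak m(\mathcal A^N)_{i_\partial}=N^{-\gamma}\sum_{i\in[N]^{E(\mathfrak m)\setminus\partial}}\prod_v(A^N_{w_v})_{i_{\partial v}}$, where $i_{\partial v}$ is the tuple of indices of the elements of $E(\mathfrak m)$ containing the half-edges of $\partial v$, $\gamma=0$ if $q\ge1$ and $\gamma=\gamma(\mathfrak m)$ if $q=0$. Operations. Let $\mathfrak m\in\mathcal M_p(\mathcal I)$ with boundary edges $(e_1,\dots,e_p)$. $\mathfrak m^{+\mathbf s}\in\mathcal M_0(\mathcal I)$ is obtained by adding a new vertex $u$ of degree $p$ with label $\mathbf s$, $\partial u=(f_1,\dots,f_p)$, and matching $f_i$ with $e_i$. For $v\in V(\mathfrak m)$ with $w_v=\mathbf s$, $\partial v=(g_1,\dots,g_p)$ and $\sigma\in\mathrm S_p$, $(\mathfrak m.\sigma)^{\backslash v}\in\mathcal M_0(\mathcal I)$ is obtained by permuting the boundary edges by $\sigma$, deleting $v$ and matching the half-edges facing $v$ with the boundary edges: in the (multi)graph on the half-edges of $\mathfrak m$ with edges $\{h,\alpha(h)\}$ ($h\neq\alpha(h)$) and $\{g_j,e_{\sigma(j)}\}$, $j\in[p]$, each path between two half-edges not attached to $v$ becomes an edge, and each cycle becomes an extra connected component without vertices, with value 1 (equivalently a single degree-2 vertex carrying the identity matrix $I_N$ with a loop edge). The constant in $O(1/N)$ may depend on $\mathfrak m$ but not on $N$. *)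

(* Defs.v *)
Set Warnings "-notation-overridden,-ambiguous-paths,-notation-incompatible-prefix".
From HB Require Import structures.
From mathcomp Require Import all_boot all_order all_algebra all_fingroup.
From mathcomp Require Import complex.
From mathcomp Require Import all_classical all_reals all_analysis.

Set Implicit Arguments.
Unset Strict Implicit.
Unset Printing Implicit Defensive.

Import Order.TTheory GRing.Theory Num.Theory.
Import numFieldNormedType.Exports.

Section Cycles.
Variables (n : nat) (s : {perm 'I_n}).

Definition pcycle := {c : {set 'I_n} | c \in porbits s}.

Lemma porbit_porbits (h : 'I_n) : porbit s h \in porbits s.
Proof. exact: imset_f. Qed.

Definition cycle_of (h : 'I_n) : pcycle := exist _ (porbit s h) (porbit_porbits h).

Lemma pcycle_ex (c : pcycle) : exists h, h \in val c.
Proof. by case: c => _ /= /imsetP[h _ ->]; exists h; exact: porbit_id. Qed.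

Definition least (c : pcycle) : 'I_n :=
  [arg min_(h < xchoose (pcycle_ex c) | h \in val c) (h : nat)].

(* The [k]-th element, from [k = 0], of the cycle [c] started at its least
   element; [k] is only used below [#|val c|]. *)
Definition cycle_nth (c : pcycle) (k : nat) : 'I_n := iter k s (least c).

Lemma least_in (c : pcycle) : least c \in val c.
Proof. by rewrite /least; case: arg_minnP => //; exact: xchooseP. Qed.

Lemma cycle_eq (c : pcycle) h : h \in val c -> val c = porbit s h.
Proof.
case: c => /= _ /imsetP[h0 _ ->] hh.
by apply/eqP; rewrite eq_porbit_mem porbit_sym.
Qed.

Lemma cycle_leastE (c : pcycle) : val c = porbit s (least c).
Proof. exact/cycle_eq/least_in. Qed.

End Cycles.

Lemma card_porbit_morph (T U : finType) (s : {perm T}) (t : {perm U})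
    (f : T -> U) (x : T) :
  injective f -> (forall y, f (s y) = t (f y)) ->
  #|porbit t (f x)| = #|porbit s x|.
Proof.
move=> finj fst; rewrite -(card_imset _ finj); apply: eq_card => u.
have fX i : f ((s ^+ i)%g x) = (t ^+ i)%g (f x).
  by elim: i => [|i IH]; rewrite ?expg0 ?perm1// !expgSr !permM fst IH.
apply/porbitP/imsetP => [[i ->]|[_ /porbitP[i ->] ->]].
  by exists ((s ^+ i)%g x); rewrite ?fX// mem_porbit.
by exists i; rewrite fX.
Qed.

Section Maps.
Variables (I : eqType) (ell : I -> nat).

(* A map on [nhe] half-edges, numbered from 0. The order of the [q] boundary edges
   is part of the data: it is arbitrary, not necessarily increasing. *)
Record cmap (q : nat) := CMap {
  nhe : nat;
  vperm : {perm 'I_nhe};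
  eperm : {perm 'I_nhe};
  bdry : q.-tuple 'I_nhe;
  epermK : involutive eperm;
  bdry_uniq : uniq bdry;
  bdryP : bdry =i [pred h | eperm h == h]
}.

Definition vertex q (m : cmap q) := pcycle (vperm m).
Definition edge q (m : cmap q) := pcycle (eperm m).

Record imap (q : nat) := IMap {
  imap_cmap :> cmap q;
  label : vertex imap_cmap -> I;
  labelP : forall v, ell (label v) = #|val v|
}.

End Maps.

Section Components.
Variables (T : finType) (e : rel T).

Definition components : {set {set T}} :=
  [set [set y | connect e x y] | x in [set: T]].

End Components.

Section MapComponents.
Variables (q : nat) (m : cmap q).

Definition adjacent : rel 'I_(nhe m) :=
  [rel x y | [|| y == vperm m x, x == vperm m y | y == eperm m x]].

Definition ncomp : nat := #|components adjacent|.

Definition connected_map : bool := ncomp == 1.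

End MapComponents.

Section AddVertex.
Variables (I : eqType) (ell : I -> nat) (s : I) (m : imap ell (ell s)).
Let n := nhe m.
Let p := ell s.

Definition add_vfun (h : 'I_(n + p)) : 'I_(n + p) :=
  match fintype.split h with
  | inl x => lshift p (vperm m x)
  | inr k => rshift n (ordS k)
  end.

Definition add_efun (h : 'I_(n + p)) : 'I_(n + p) :=
  match fintype.split h with
  | inl x => if [pick k | tnth (bdry m) k == x] is Some k
             then rshift n k else lshift p (eperm m x)
  | inr k => lshift p (tnth (bdry m) k)
  end.

Lemma splitl (x : 'I_n) : fintype.split (lshift p x) = inl x.
Proof. exact: (unsplitK (inl x)). Qed.

Lemma splitr (k : 'I_p) : fintype.split (rshift n k) = inr k.
Proof. exact: (unsplitK (inr k)). Qed.

Lemma add_vfun_inj : injective add_vfun.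
Proof.
move=> x y; rewrite -[x]splitK -[y]splitK /add_vfun.
case: (fintype.split x) => a; case: (fintype.split y) => b; rewrite /= ?splitl ?splitr.
- by move=> /lshift_inj /perm_inj ->.
- by move=> /eqP; rewrite eq_lrshift.
- by move=> /eqP; rewrite eq_rlshift.
- by move=> /rshift_inj /(@ordS_inj _) ->.
Qed.

Lemma tnth_bdry_inj q (m' : cmap q) : injective (tnth (bdry m')).
Proof. by apply/tuple_uniqP; exact: bdry_uniq. Qed.

Lemma add_efunK : involutive add_efun.
Proof.
move=> h; rewrite -[h]splitK; case: (fintype.split h) => [x|k];
  rewrite {2}/add_efun /= ?splitl ?splitr.
- case: pickP => [k /eqP <-|xNb].
    by rewrite /add_efun splitr.
  rewrite /add_efun splitl; case: pickP => [k /eqP kx|_]; last by rewrite epermK.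
  have := mem_tnth k (bdry m); rewrite bdryP inE kx epermK => /eqP xfix.
  by have := xNb k; rewrite kx -xfix eqxx.
- rewrite /add_efun splitl; case: pickP => [j /eqP /tnth_bdry_inj -> //|].
  by move=> /(_ k); rewrite eqxx.
Qed.

Lemma add_efun_inj : injective add_efun.
Proof. exact: inv_inj add_efunK. Qed.

Lemma add_bdryP :
  [tuple] =i [pred h | perm add_efun_inj h == h].
Proof.
move=> h; rewrite in_nil inE permE; apply/esym/negbTE.
rewrite -[h]splitK; case: (fintype.split h) => [x|k];
  rewrite /add_efun /= ?splitl ?splitr; last by rewrite eq_lrshift.
case: pickP => [k _|xNb]; first by rewrite eq_rlshift.
rewrite eq_lshift; apply/negP => xfix.
have /tnthP[k xk] : x \in bdry m by rewrite bdryP inE.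
by have := xNb k; rewrite -xk eqxx.
Qed.

Lemma add_epermK : involutive (perm add_efun_inj).
Proof. by move=> h; rewrite !permE add_efunK. Qed.

Definition add_cmap : cmap 0 :=
  @CMap 0 (n + p) (perm add_vfun_inj) (perm add_efun_inj) [tuple]
    add_epermK isT add_bdryP.

Definition add_label (v : vertex add_cmap) : I :=
  match fintype.split (least v) with
  | inl h => label (cycle_of (vperm m) h)
  | inr _ => s
  end.

Lemma card_porbit_ordS r (k : 'I_r) : #|porbit (perm (@ordS_inj r)) k| = r.
Proof.
transitivity #|'I_r|; last by rewrite card_ord.
apply: eq_card => j; rewrite inE; apply/porbitP.
have X i (x : 'I_r) : ((perm (@ordS_inj r) ^+ i)%g x : nat) = (x + i) %% r.
  elim: i => [|i IH]; first by rewrite expg0 perm1 addn0 modn_small.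
  by rewrite expgSr permM permE /= IH -addn1 modnDml addn1 addnS.
exists (j + (r - k)); apply: val_inj; rewrite /= X addnCA subnKC; last exact: ltnW.
by rewrite modnDr modn_small.
Qed.

Lemma add_labelP v : ell (add_label v) = #|val v|.
Proof.
rewrite /add_label cycle_leastE -[in RHS](splitK (least v)).
case: (fintype.split (least v)) => [h|k].
  rewrite labelP; apply: esym.
  apply: (@card_porbit_morph _ _ _ _ (@lshift n p)); first exact: lshift_inj.
  by move=> y; rewrite permE /add_vfun splitl.
rewrite -[LHS](card_porbit_ordS k); apply: esym.
apply: (@card_porbit_morph _ _ _ _ (@rshift n p)); first exact: rshift_inj.
by move=> y; rewrite !permE /add_vfun splitr.
Qed.

(* The half-edges of the new vertex are [rshift n k], [k < p], in this order, the
   half-edges [lshift p x] being those of [m]. *)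
Definition add_vertex : imap ell 0 := IMap add_labelP.

End AddVertex.

Section PermuteBoundary.
Variables (I : eqType) (ell : I -> nat) (q : nat) (m : imap ell q) (sigma : 'S_q).

Definition permuted_bdry : q.-tuple 'I_(nhe m) :=
  [tuple tnth (bdry m) (sigma k) | k < q].

Lemma permuted_bdry_uniq : uniq permuted_bdry.
Proof.
apply/tuple_uniqP => i j; rewrite !tnth_mktuple.
by move=> /tnth_bdry_inj /perm_inj.
Qed.

Lemma permuted_bdryP : permuted_bdry =i [pred h | eperm m h == h].
Proof.
move=> h; rewrite -bdryP; apply/tnthP/tnthP => [[k ->]|[k ->]].
  by exists (sigma k); rewrite tnth_mktuple.
by exists ((sigma^-1)%g k); rewrite tnth_mktuple permKV.
Qed.

Definition permute_bdry : imap ell q :=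
  @IMap _ ell q
    (@CMap q (nhe m) (vperm m) (eperm m) permuted_bdry
      (@epermK _ m) permuted_bdry_uniq permuted_bdryP)
    (@label _ _ _ m) (@labelP _ _ _ m).

End PermuteBoundary.

(* Two involutions [a], [b], [a] without fixed point: the orbit of a fixed point
   [x] of [b] contains exactly one other fixed point of [b]. *)
Section TwoInvolutions.
Variables (U : finType) (a b : {perm U}).
Hypotheses (aK : involutive a) (bK : involutive b) (aN : forall u, a u != u).
Variables (rho : {perm U}) (rhoP : forall u, rho u = a (b u)).
Variable x : U.
Hypothesis bx : b x = x.
Let o := #|porbit rho x|.

Let brho i : (rho ^+ i)%g (b ((rho ^+ i)%g x)) = x.
Proof.
elim: i => [|i IH]; first by rewrite !expg0 !perm1.
have H u : rho (b (rho u)) = b u by rewrite !rhoP bK aK.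
by rewrite {1}expgS permM expgSr permM H IH.
Qed.

Let arho i : (rho ^+ i)%g (a ((rho ^+ i)%g x)) = rho x.
Proof.
case: i => [|i]; first by rewrite !expg0 !perm1 rhoP bx.
have H u : a (rho u) = b u by rewrite rhoP aK.
by rewrite !expgSr !permM H brho.
Qed.

Let rhoo : (rho ^+ o)%g x = x.
Proof. by rewrite permX; exact: iter_porbit. Qed.

Let o_gt0 : 0 < o.
Proof. by apply/card_gt0P; exists x; exact: porbit_id. Qed.

Let rhom k : (rho ^+ k)%g x = (rho ^+ (k %% o))%g x.
Proof.
rewrite {1}(divn_eq k o) expgD permM mulnC expgM; congr (fun_of_perm (_ ^+ _)%g _).
by elim: (k %/ o) => [|l IH]; rewrite ?expg0 ?perm1// expgSr permM IH rhoo.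
Qed.

Let rhoE i j : (rho ^+ i)%g x = (rho ^+ j)%g x -> i = j %[mod o].
Proof.
rewrite rhom (rhom j) !permX => H; apply/eqP.
have tE k : k < o -> iter k rho x = nth x (traject rho x o) k.
  by move=> ko; rewrite nth_traject.
move: H; rewrite !tE ?ltn_mod// => /eqP; rewrite nth_uniq ?size_traject ?ltn_mod//.
exact: uniq_traject_porbit.
Qed.

Lemma two_inv_closed u : u \in porbit rho x ->
  (a u \in porbit rho x) /\ (b u \in porbit rho x).
Proof.
have bin v : v \in porbit rho x -> b v \in porbit rho x.
  move=> /porbitP[i ->]; rewrite -{2}(brho i); rewrite porbit_perm porbit_id.
  done.
move=> uin; split; last exact: bin.
rewrite -{1}(bK u) -rhoP; have /porbitP[i ->] := bin _ uin.
by rewrite -permM -expgSr mem_porbit.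
Qed.

Lemma two_inv : exists2 y, [/\ y \in porbit rho x, b y = y & y != x] &
  forall z, z \in porbit rho x -> b z = z -> z = x \/ z = y.
Proof.
have odd_o : ~~ odd o.
  apply/negP => oo.
  have /negP[] := aN ((rho ^+ uphalf o)%g x); apply/eqP.
  apply: (@perm_inj _ (rho ^+ uphalf o)%g); rewrite arho -permM -expgD addnn.
  have -> : (uphalf o).*2 = o.+1 by rewrite uphalfE halfK /= oo subn0.
  by rewrite expgSr permM rhoo.
have o2 : o = (o./2).*2 by rewrite -{1}(odd_double_half o) (negbTE odd_o).
exists ((rho ^+ o./2)%g x); first split.
- exact: mem_porbit.
- by apply: (@perm_inj _ (rho ^+ o./2)%g); rewrite brho -permM -expgD addnn -o2.
- apply/eqP => H; have := @rhoE o./2 0; rewrite expg0 perm1 => /(_ H) /eqP.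
  have h0 : 0 < o./2 by rewrite -double_gt0 -o2.
  by rewrite mod0n modn_small ?eqn0Ngt ?h0// [ltnRHS]o2 -addnn -addn1 leq_add2l.
move=> z; rewrite porbit_traject => /trajectP[i io ->]; rewrite -permX => bz.
have := brho i; rewrite bz -permM -expgD addnn.
move=> H; have := @rhoE i.*2 0; rewrite expg0 perm1 => /(_ H) /eqP; rewrite mod0n.
move=> /dvdnP[[|[|k]] ik].
- by left; have -> : i = 0 by [case: (i) ik]; rewrite expg0 perm1.
- right; rewrite mul1n in ik; congr (fun_of_perm (_ ^+ _)%g _).
  by rewrite -ik doubleK.
- have : i.*2 < o.*2 by rewrite ltn_double.
  by rewrite ik -mul2n ltn_pmul2r.
Qed.

End TwoInvolutions.

Section SubFun.
Variables (T : finType) (S : {set T}) (f : T -> T).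
Hypothesis fS : {in S, forall x, f x \in S}.

(* The function [f], restricted to [S] and transported to ['I_#|S|] by the
   increasing enumeration [enum_val] of [S]. *)
Definition sub_fun (k : 'I_#|S|) : 'I_#|S| :=
  enum_rank_in (enum_valP k) (f (enum_val k)).

Lemma sub_funE k : enum_val (sub_fun k) = f (enum_val k).
Proof. by rewrite enum_rankK_in// fS// enum_valP. Qed.

Lemma sub_fun_inj : {in S &, injective f} -> injective sub_fun.
Proof.
move=> finj x y xy; apply: enum_val_inj.
by apply: finj; rewrite ?enum_valP// -!sub_funE xy.
Qed.

Lemma sub_funK : {in S, involutive f} -> involutive sub_fun.
Proof.
by move=> fK k; apply: enum_val_inj; rewrite !sub_funE fK// enum_valP.
Qed.

End SubFun.

Section DeleteVertex.
Variables (I : eqType) (ell : I -> nat) (q : nat) (m : imap ell q).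
Variables (v : vertex m) (hv : #|val v| = q).
Let n := nhe m.
Let S : {set 'I_n} := ~: val v.

(* The half-edges [cycle_nth v j], [j < q], form the cycle of [v]. *)
Definition glue_graph : rel 'I_n :=
  [rel x y | [|| (x != y) && (y == eperm m x),
    [exists j : 'I_q, (x == cycle_nth v j) && (y == tnth (bdry m) j)] |
    [exists j : 'I_q, (y == cycle_nth v j) && (x == tnth (bdry m) j)]]].

(* In the multigraph the half-edges attached to [v] have degree 2 (a loop counting
   twice) and the other ones degree 1: the components of [glue_graph] are its
   paths, which join two half-edges not attached to [v], and its cycles, which
   only visit half-edges attached to [v]. *)
Definition other_end (x : 'I_n) : 'I_n :=
  odflt x [pick y | [&& y \notin val v, y != x & connect glue_graph x y]].

Definition ncircles : nat :=
  #|[set c in components glue_graph | c \subset val v]|.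

Let a : {perm 'I_n} := eperm m.
Let g (j : 'I_q) : 'I_n := cycle_nth v j.
Let bd (j : 'I_q) : 'I_n := tnth (bdry m) j.

Lemma cycle_nth_inj : injective g.
Proof.
move=> i j ij; apply: val_inj => /=.
have vE := cycle_leastE v.
have ltv (k : 'I_q) : k < #|porbit (vperm m) (least v)| by rewrite -vE hv.
have tE (k : 'I_q) : g k =
    nth (least v) (traject (vperm m) (least v) #|porbit (vperm m) (least v)|) k.
  by rewrite nth_traject.
move: ij; rewrite !tE => /eqP.
by rewrite nth_uniq ?size_traject ?ltv// ?uniq_traject_porbit// => /eqP.
Qed.

Lemma cycle_nthP x : reflect (exists j, g j = x) (x \in val v).
Proof.
rewrite cycle_leastE porbit_traject -cycle_leastE hv.
apply: (iffP trajectP) => [[i iq ->]|[j <-]]; first by exists (Ordinal iq).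
by exists (val j); first exact: ltn_ord.
Qed.

Let bdP x : reflect (exists j, bd j = x) (a x == x).
Proof.
have -> : (a x == x) = (x \in bdry m) by rewrite bdryP.
by apply: (iffP (tnthP _ _)) => -[j Hj]; exists j; exact: esym Hj.
Qed.

Let bd_inj : injective bd. Proof. exact: tnth_bdry_inj. Qed.

Let Afun (u : 'I_n + 'I_q) : 'I_n + 'I_q :=
  match u with
  | inl x => if [pick j | bd j == x] is Some j then inr j else inl (a x)
  | inr j => inl (bd j)
  end.

Let Bfun (u : 'I_n + 'I_q) : 'I_n + 'I_q :=
  match u with
  | inl x => if [pick j | g j == x] is Some j then inr j else inl x
  | inr j => inl (g j)
  end.

Let pickbd j : [pick k | bd k == bd j] = Some j.
Proof. by case: pickP => [k /eqP /bd_inj ->//|/(_ j)]; rewrite eqxx. Qed.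

Let pickg j : [pick k | g k == g j] = Some j.
Proof. by case: pickP => [k /eqP /cycle_nth_inj ->//|/(_ j)]; rewrite eqxx. Qed.

Let AK : involutive Afun.
Proof.
case=> [x|j] /=; last by rewrite pickbd.
case: pickP => [j /eqP <-//|xN] /=.
case: pickP => [j /eqP jE|_]; last by rewrite /a epermK.
have /bdP : exists j, bd j = a x by exists j.
rewrite {1}/a epermK => /eqP xx.
by have := xN j; rewrite jE -xx eqxx.
Qed.

Let BK : involutive Bfun.
Proof.
case=> [x|j] /=; last by rewrite pickg.
by case: pickP => [j /eqP <-//|xN] /=; case: pickP => // j; rewrite xN.
Qed.

Let AN u : Afun u != u.
Proof.
case: u => [x|j] //=; case: pickP => [j //|xN].
apply/eqP => -[] /eqP /bdP[j jE].
by have := xN j; rewrite jE eqxx.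
Qed.

Let BfixN x : x \notin val v -> Bfun (inl x) = inl x.
Proof.
move=> xv /=; case: pickP => // j /eqP jE.
by move: xv; rewrite -jE; move/negP; case; apply/cycle_nthP; exists j.
Qed.

Let Bfix u : Bfun u = u -> exists2 x, x \notin val v & u = inl x.
Proof.
case: u => [x|j] //= H; exists x => //; apply/negP => /cycle_nthP[j jE].
by move: H; rewrite -jE pickg.
Qed.

Let A := perm (inv_inj AK).
Let B := perm (inv_inj BK).
Let rho := (B * A)%g.

Lemma glue_graph_sym : symmetric glue_graph.
Proof.
move=> x y; rewrite /glue_graph /= eq_sym; congr (_ || _).
  by congr (_ && _); apply/eqP/eqP => ->; rewrite epermK.
by rewrite orbC.
Qed.

Let csym : connect_sym glue_graph.
Proof. exact/sym_connect_sym/glue_graph_sym. Qed.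

Lemma glue_graph_ends x : x \notin val v ->
  exists2 y, [/\ y \notin val v, y != x & connect glue_graph x y] &
    forall z, z \notin val v -> connect glue_graph x z -> z = x \/ z = y.
Proof.
move=> xv.
have rhoP u : rho u = A (B u) by rewrite permM.
have AK' : involutive A by move=> u; rewrite !permE AK.
have BK' : involutive B by move=> u; rewrite !permE BK.
have AN' u : A u != u by rewrite permE AN.
have Bx : B (inl x) = inl x by rewrite permE BfixN.
have [w [wx Bw wNx] wuniq] := two_inv AK' BK' AN' rhoP Bx.
have gbd j : connect glue_graph (g j) (bd j).
  apply: connect1; apply/or3P; apply: Or32; apply/existsP.
  by exists j; rewrite !eqxx.
have ca y : connect glue_graph y (a y).
  have [yy|yy] := eqVneq y (a y); first by rewrite -yy.
  by apply: connect1; apply/or3P; apply: Or31; rewrite yy eqxx.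
pose C (u : 'I_n + 'I_q) := match u with
  | inl y => connect glue_graph x y | inr j => connect glue_graph x (bd j) end.
have CA u : C u -> C (A u).
  rewrite permE; case: u => [y|j] //= xy.
  case: pickP => [j /eqP jE|_] /=; first by rewrite jE.
  exact: connect_trans xy (ca y).
have CB u : C u -> C (B u).
  rewrite permE; case: u => [y|j] /= xy.
    case: pickP => [j /eqP jE|_] //=.
    by apply: connect_trans xy _; rewrite -jE.
  by apply: connect_trans xy _; rewrite csym.
have Crho u : u \in porbit rho (inl x) -> C u.
  move=> /porbitP[i ->]; elim: i => [|i IH]; first by rewrite expg0 perm1 /=.
  by rewrite expgSr permM rhoP; exact/CA/CB.
have cl := two_inv_closed AK' BK' rhoP Bx.
have porb y : connect glue_graph x y -> inl y \in porbit rho (inl x).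
  move=> /connectP[s sp ->]; rewrite -[s]revK in sp *.
  elim: (rev s) sp => [|z t IH]; first by rewrite porbit_id.
  rewrite rev_cons rcons_path last_rcons => /andP[/IH {}IH].
  move: (last _ _) IH => u uin.
  have gb j : inl (g j) \in porbit rho (inl x) -> inl (bd j) \in porbit rho (inl x).
    move=> /cl[_]; rewrite permE /= pickg => /cl[+ _].
    by rewrite permE.
  have bg j : inl (bd j) \in porbit rho (inl x) -> inl (g j) \in porbit rho (inl x).
    move=> /cl[+ _]; rewrite permE /= pickbd => /cl[_].
    by rewrite permE.
  case/or3P => [/andP[uz /eqP zE]|/existsP[j /andP[/eqP uE /eqP ->]]|
    /existsP[j /andP[/eqP -> /eqP uE]]].
  - have [+ _] := cl _ uin; rewrite permE /=; case: pickP => [j /eqP jE|_].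
      have /bdP/eqP : exists j, bd j = u by exists j.
      by rewrite /a -zE => ze; rewrite ze eqxx in uz.
    by rewrite /a -zE.
  - by apply: gb; rewrite /g -uE.
  - by apply: bg; rewrite /bd -uE.
have [y yv yE] : exists2 y, y \notin val v & w = inl y.
  by apply: Bfix; move: Bw; rewrite permE.
subst w; exists y; first split => //.
  exact: (Crho _ wx).
move=> z zv /porb zx; have [|[->]|[->]] := wuniq _ zx; [|by left|by right].
by rewrite permE BfixN.
Qed.

Lemma other_endP x : x \in S ->
  [/\ other_end x \in S, other_end x != x & connect glue_graph x (other_end x)].
Proof.
rewrite inE => xv; have [y [yv yx xy] _] := glue_graph_ends xv.
rewrite /other_end; case: pickP => [z /and3P[zv zx xz]|/(_ y)].
  by rewrite inE.
by rewrite yv yx xy.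
Qed.

Lemma other_end_in : {in S, forall x, other_end x \in S}.
Proof. by move=> x /other_endP[]. Qed.

Lemma other_endK : {in S, involutive other_end}.
Proof.
move=> x xS; have [yS yx xy] := other_endP xS.
have [zS zy yz] := other_endP yS.
move: xS yS zS; rewrite !inE => xv yv zv.
have [w _ wuniq] := glue_graph_ends xv.
have [//|zw] := wuniq _ zv (connect_trans xy yz).
have [yE|yw] := wuniq _ yv xy; first by rewrite yE eqxx in yx.
by move: zy; rewrite zw -yw eqxx.
Qed.

Lemma vperm_in : {in S, forall x, vperm m x \in S}.
Proof.
move=> x; rewrite !inE; apply: contra => h.
by rewrite (cycle_eq h) porbit_sym -{1}(expg1 (vperm m)) mem_porbit.
Qed.

Definition del_vfun : 'I_#|S| -> 'I_#|S| := sub_fun (vperm m).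
Definition del_efun : 'I_#|S| -> 'I_#|S| := sub_fun other_end.

Lemma del_vfun_inj : injective del_vfun.
Proof. by apply: (sub_fun_inj vperm_in) => x y _ _; exact: perm_inj. Qed.

Lemma del_efunK : involutive del_efun.
Proof. exact: (sub_funK other_end_in other_endK). Qed.

Lemma del_efun_inj : injective del_efun.
Proof. exact: inv_inj del_efunK. Qed.

Lemma del_epermK : involutive (perm del_efun_inj).
Proof. by move=> k; rewrite !permE del_efunK. Qed.

Lemma del_bdryP : [tuple] =i [pred k | perm del_efun_inj k == k].
Proof.
move=> k; rewrite in_nil inE permE; apply/esym/negbTE/eqP => kE.
have [_ /eqP kN _] := other_endP (enum_valP k); apply: kN.
by rewrite -(sub_funE other_end_in) -/(del_efun k) kE.
Qed.

Definition del_cmap : cmap 0 :=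
  @CMap 0 #|S| (perm del_vfun_inj) (perm del_efun_inj) [tuple]
    del_epermK isT del_bdryP.

Definition del_label (w : vertex del_cmap) : I :=
  label (cycle_of (vperm m) (enum_val (least w))).

Lemma del_labelP w : ell (del_label w) = #|val w|.
Proof.
rewrite labelP [in RHS]cycle_leastE.
have fv (k : 'I_#|S|) : enum_val (vperm del_cmap k) = vperm m (enum_val k).
  by rewrite permE (sub_funE vperm_in).
exact: (card_porbit_morph (least w) enum_val_inj fv).
Qed.

Definition del_imap : imap ell 0 := IMap del_labelP.

End DeleteVertex.

Section Delete.
Variables (I : eqType) (ell : I -> nat) (s : I) (m : imap ell (ell s)).

Definition labelled_vertex := {v : vertex m | label v == s}.

Lemma labelled_vertex_card (v : labelled_vertex) : #|val (val v)| = ell s.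
Proof. by rewrite -labelP; congr ell; exact/eqP/(valP v). Qed.

(* The circles are not part of [delete v]: having value 1 each, they do not
   contribute to the trace action. They do count as connected components. *)
Definition delete (v : labelled_vertex) : imap ell 0 :=
  del_imap (labelled_vertex_card v).

Definition delete_ncomp (v : labelled_vertex) : nat :=
  ncomp (delete v) + ncircles (val v).

End Delete.

Arguments add_vertex {I ell} s m.
Arguments labelled_vertex {I ell} s m.
Arguments delete {I ell} s m v.
Arguments delete_ncomp {I ell} s m v.

Local Open Scope ring_scope.
Local Open Scope complex_scope.

Section TraceAction.
Variables (R : realType) (N : nat).

Definition tensor (q : nat) : Type := q.-tuple 'I_N -> R[i].

Definition tensor_family (I : Type) (ell : I -> nat) : Type :=
  forall i : I, tensor (ell i).

Definition conj_stable (I : Type) (ell : I -> nat) (A : tensor_family ell) :=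
  forall i : I, exists j : I, exists e : ell i = ell j,
    forall t : (ell i).-tuple 'I_N, A j (tcast e t) = (A i t)^*.

(* [label v] has order [#|val v|], so that the tuple of indices below runs once
   around [v] from its least half-edge. Families of indices of the inner edges are
   families of indices of all the edges with the values [b] on the boundary. *)
Definition trace_action (I : eqType) (ell : I -> nat) (A : tensor_family ell)
    (q : nat) (m : imap ell q) : tensor q := fun b =>
  N%:R ^- (if q == 0%N then ncomp m else 0%N) *
  \sum_(i : {ffun edge m -> 'I_N} |
         [forall k : 'I_q, i (cycle_of (eperm m) (tnth (bdry m) k)) == tnth b k])
    \prod_(v : vertex m)
      A (label v)
        [tuple i (cycle_of (eperm m) (cycle_nth v k)) | k < ell (label v)].

Definition trace_scalar (I : eqType) (ell : I -> nat) (A : tensor_family ell)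
    (m : imap ell 0) : R[i] := trace_action A m [tuple].

End TraceAction.

Section GaussianTensor.
Variables (d : measure_display) (T : measurableType d) (R : realType).
Variable P : probability T R.

Definition mutually_independent (K : finType) (J : {set K})
    (X : K -> {RV P >-> R}) : Prop :=
  forall (L : {set K}) (B : K -> set R), L \subset J ->
    (forall k, measurable (B k)) ->
    P (\bigcap_(k in [set` L]) (X k @^-1` B k))%classic =
    (\prod_(k in L) P (X k @^-1` B k)%classic)%E.

Definition nperms (N p : nat) (i : p.-tuple 'I_N) : nat :=
  #|[set j : p.-tuple 'I_N | perm_eq j i]|.

(* [normal_prob m sd] has mean [m] and standard deviation [sd]. Independence of
   the classes is that of the entries along any set of pairwise inequivalent
   indices. *)
Definition gaussian_symmetric_tensor (N p : nat)
    (X : p.-tuple 'I_N -> {RV P >-> R}) : Prop :=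
  [/\ forall i j : p.-tuple 'I_N, perm_eq i j -> forall w, X i w = X j w,
      forall J : {set p.-tuple 'I_N},
        {in J &, forall i j : p.-tuple 'I_N, perm_eq i j -> i = j} ->
        mutually_independent J X
    & forall (i : p.-tuple 'I_N) (B : set R), measurable B ->
        distribution P (X i) B =
        normal_prob 0 (Num.sqrt (p%:R / (nperms i)%:R)) B].

Definition complex_expectation (Z : T -> R[i]) : R[i] :=
  fine 'E_P[fun w => complex.Re (Z w)] +i* fine 'E_P[fun w => complex.Im (Z w)].

End GaussianTensor.

Section ExtendedFamily.
Variables (I0 : eqType) (ell0 : I0 -> nat) (p : nat).

(* The added label is [None]. *)
Definition ext_ell (i : option I0) : nat := if i is Some i0 then ell0 i0 else p.

Definition ext_family (R : realType) (N : nat) (A0 : tensor_family R N ell0)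
    (W : p.-tuple 'I_N -> R) : tensor_family R N ext_ell :=
  fun i => match i return tensor R N (ext_ell i) with
           | Some i0 => A0 i0
           | None => fun t => (W t)%:C
           end.

Definition expected_trace (d : measure_display) (T : measurableType d)
    (R : realType) (P : probability T R) (N : nat)
    (A0 : tensor_family R N ell0) (X : p.-tuple 'I_N -> {RV P >-> R})
    (n : imap ext_ell 0) : R[i] :=
  complex_expectation P (fun w =>
    trace_scalar
      (ext_family A0 (fun t => X t w / N%:R `^ ((p%:R - 1) / 2))) n).

End ExtendedFamily.

(* Main.v *)
Require Import Defs.
Set Warnings "-notation-overridden,-ambiguous-paths,-notation-incompatible-prefix".
From mathcomp Require Import all_boot all_order all_algebra all_fingroup.
From mathcomp Require Import complex.
From mathcomp Require Import all_classical all_reals all_analysis.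
From mathcomp Require Import measurable_realfun ring.

(* Expand the trace action of m^{+s} as a sum over indices and apply Gaussian
   integration by parts to the entry W_t sitting at the new vertex u. As
   E[X_t X_t'] = #{sigma | t o sigma = t'} / (p-1)!, this pairs u with every other
   vertex v labelled s and every sigma in S_p, removes u and v and identifies the
   indices of their half-edges along sigma, which is the contraction of
   (m.sigma)^{\v}. Counting powers of N gives the exact identity
     E_N[m^{+s}] = 1/(p-1)! sum_{v,sigma} N^(c(v,sigma) - p) E_N[(m.sigma)^{\v}],
   where c(v,sigma) <= p is the number of components of (m.sigma)^{\v}. It remains
   to see that E_N[n] is bounded for each closed map n: the same integration by
   parts removes two vertices labelled s at a time, never increases the power of N,
   and ends either with 0 or with a map without label s, to which (A1) applies. *)

Set Implicit Arguments.
Unset Strict Implicit.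
Unset Printing Implicit Defensive.

Import Order.TTheory GRing.Theory Num.Theory.
Import numFieldNormedType.Exports.

Local Open Scope ring_scope.
Local Open Scope complex_scope.

(** * Independent Gaussian variables *)

(** Deleting vertices from maps renumbers half-edges at every step, which would make a recursion on
    maps unmanageable. The recursion therefore runs on networks over a fixed set of points: gluing
    only lengthens the list [E] and shrinks the set [L], and maps are compared with networks only at
    the two ends. The classes of [E ++ cliques h deg L] play the role of connected components. A
    circle is such a class without half-edge: it contributes one free index, hence a factor N, and
    one component, hence a factor 1/N, so that its value is 1. The scaling of W is exactly the right
    one: a contraction costs a factor N^(1-p), and it creates at most p-1 new classes. This single
    count gives both c(v,sigma) <= p and the boundedness of the expected traces. Integration by
    parts is only ever done in one variable: independence of the entries at representatives of the
    classes splits a monomial into powers of single Gaussian variables. *)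

Section Density.
Local Open Scope classical_set_scope.
Context d d' (T : measurableType d) (T' : measurableType d') (R : realType).
Variables (mu : {measure set T -> \bar R}) (nu : {measure set T' -> \bar R}).
Variables (g : T -> R) (Y : T -> T').
Hypotheses (mg : measurable_fun setT g) (g0 : forall x, 0 <= g x).
Hypothesis mY : measurable_fun setT Y.
Hypothesis nuE : forall B, measurable B ->
  nu B = (\int[mu]_x (g x * \1_B (Y x))%:E)%E.

Import HBNNSimple.

Let mgf (f : T' -> R) : measurable_fun setT f ->
  measurable_fun setT (EFin \o ((fun x => g x * f (Y x)) : T -> R)).
Proof.
move=> mf; apply/measurable_EFinP/measurable_funM => //.
exact: measurableT_comp.
Qed.

Let density_nnsfun (f : {nnsfun T' >-> R}) :
  (\int[nu]_y (f y)%:E = \int[mu]_x (g x * f (Y x))%:E)%E.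
Proof.
under [LHS]eq_integral do rewrite fimfunE -fsumEFin//.
rewrite [LHS]ge0_integral_fsum//; last 2 first.
  - by move=> r; exact/measurable_EFinP/measurableT_comp.
  - by move=> n x _; rewrite EFinM nnfun_muleindic_ge0.
under [RHS]eq_integral.
  move=> x xD; rewrite fimfunE EFinM -fsumEFin// ge0_mule_fsumr; last first.
    by move=> r; rewrite EFinM nnfun_muleindic_ge0.
  over.
rewrite [RHS]ge0_integral_fsum//; last 2 first.
  - move=> r; apply: emeasurable_funM; first exact/measurable_EFinP.
    apply/measurable_EFinP; apply: measurable_funM => //.
    by apply: measurableT_comp => //; exact: measurable_indic.
  - move=> n x _; rewrite EFinM mule_ge0//; first by rewrite lee_fin.
    by rewrite nnfun_muleindic_ge0.
apply: eq_fsbigr => r _.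
rewrite integralZl_indic_nnsfun//= integral_indic// setIT nuE//.
(* A negative value is never taken by [f], so both sides vanish; for the others the constant can be
   moved into the integral. *)
have [r0|r0] := ltP r 0.
  rewrite preimage_nnfun0// indic0 !integral0_eq ?mule0// => x _;
    by rewrite !mulr0 ?mule0.
rewrite -ge0_integralZl_EFin//; last 2 first.
  - by move=> x _; rewrite lee_fin mulr_ge0.
  - by apply: (@mgf \1__); exact: measurable_indic.
by apply: eq_integral => x _; rewrite -!EFinM mulrCA.
Qed.

(** Simple functions and monotone convergence. Having both a weight [g] and a map [Y] lets it serve
    twice: for independence, [g] is the product of the other factors and [Y] one variable; for the
    normal law, [g] is the density and [Y] the identity. *)
Lemma ge0_integral_density (f : T' -> R) : measurable_fun setT f ->
  (forall y, 0 <= f y) ->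
  (\int[nu]_y (f y)%:E = \int[mu]_x (g x * f (Y x))%:E)%E.
Proof.
move=> mf f0.
have mf' : measurable_fun [set: T'] (EFin \o f) by exact/measurable_EFinP.
pose f_ := nnsfun_approx measurableT mf'.
transitivity (lim (\int[nu]_x (f_ n x)%:E @[n --> \oo])%E).
  rewrite -monotone_convergence//=.
  - apply: eq_integral => ? /[!inE] xD; apply/esym/cvg_lim => //=.
    by apply: (@cvg_nnsfun_approx _ _ _ _ measurableT _ mf') => // x _; rewrite lee_fin.
  - by move=> n; exact/measurable_EFinP/measurable_funTS.
  - by move=> n ? _; rewrite lee_fin.
  - by move=> ? _ ? ? mn; rewrite lee_fin; exact/lefP/nd_nnsfun_approx.
rewrite [RHS](_ : _ = lim (\int[mu]_x (g x * f_ n (Y x))%:E @[n --> \oo])%E).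
  have -> // : (fun n => \int[nu]_x (f_ n x)%:E)%E =
      (fun n => \int[mu]_x (g x * f_ n (Y x))%:E)%E.
  by apply/funext => n; exact: density_nnsfun.
rewrite -monotone_convergence//=.
- apply: eq_integral => x _; apply/esym/cvg_lim => //=.
  have -> : (fun n => (g x * f_ n (Y x))%:E) = (fun n => (g x)%:E * (f_ n (Y x))%:E)%E.
    by apply/funext => n; rewrite EFinM.
  rewrite EFinM; apply: (@cvgeZl _ _ R (fun n => (f_ n (Y x))%:E)) => //.
  by apply: (@cvg_nnsfun_approx _ _ _ _ measurableT _ mf') => // y _; rewrite lee_fin.
- by move=> n; exact: mgf.
- by move=> n ? _; rewrite lee_fin mulr_ge0.
- move=> x _ a b ab; rewrite lee_fin ler_wpM2l//.
  exact/lefP/nd_nnsfun_approx.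
Qed.

End Density.

Section Independence.
Local Open Scope classical_set_scope.
Context d (T : measurableType d) (R : realType) (P : probability T R).
Variables (K : finType) (J : {set K}) (X : K -> {RV P >-> R}).
Hypothesis indep : mutually_independent J X.

Let mX k : measurable_fun setT (X k).
Proof. exact: measurable_funP. Qed.

Let mprod (L : {set K}) (f : K -> R -> R) :
  (forall k, measurable_fun setT (f k)) ->
  measurable_fun setT (fun w => \prod_(k in L) f k (X k w)).
Proof.
move=> mf.
have -> : (fun w => \prod_(k in L) f k (X k w)) =
          (fun w => \prod_(k <- enum L) f k (X k w)).
  by apply/funext => w; rewrite big_enum.
by apply: measurable_prod => k _; exact: measurableT_comp.
Qed.

(* Starts from indicators (the definition of independence); each step replaces one
   of them by a general function, comparing two measures on the line. *)
Let ge0_indep n (S L : {set K}) (f : K -> R -> R) (B : K -> set R) :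
  L \subset J -> #|S| = n -> S \subset L ->
  (forall k, measurable_fun setT (f k)) -> (forall k y, 0 <= f k y) ->
  (forall k, (\int[P]_w (f k (X k w))%:E < +oo)%E) ->
  (forall k, measurable (B k)) ->
  {in L :\: S, forall k, f k = \1_(B k)} ->
  (\int[P]_w (\prod_(k in L) f k (X k w))%:E =
   \prod_(k in L) \int[P]_w (f k (X k w))%:E)%E.
Proof.
move=> LJ; elim: n S f B => [|n IH] S f B cS SL mf f0 fi mB fB.
  have S0 : S = finset.set0 by apply/eqP; rewrite -cards_eq0 cS.
  rewrite S0 finset.setD0 in fB.
  transitivity (P (\bigcap_(k in [set` L]) (X k @^-1` B k))).
    rewrite -[in RHS](setIT (bigcap _ _)) -integral_indic//; last first.
      apply: fin_bigcap_measurable => // k _; rewrite -[X in measurable X]setTI.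
      exact: mX.
    apply: eq_integral => w _; congr EFin.
    rewrite indicE; case: (boolP (w \in _)) => [|]; rewrite ?inE ?notin_setE.
      move=> h; rewrite big1// => k kL; rewrite fB// indicE mem_set//.
      exact: h.
    move=> h; apply/eqP/prodf_eq0.
    have [k kL kB] : exists2 k, k \in L & ~ B k (X k w).
      apply: contrapT => hn; apply: h => k /= kL.
      by apply: contrapT => hk; apply: hn; exists k.
    exists k => //; rewrite fB ?finset.setD0// indicE memNset//.
  rewrite indep//; apply: eq_bigr => k kL; rewrite fB//.
  have mk : measurable (X k @^-1` B k) by rewrite -[X in measurable X]setTI; exact: mX.
  by rewrite -[in LHS](setIT (_ @^-1` _)) -integral_indic.
have [k kS] : exists k, k \in S by apply/fintype.card_gt0P; rewrite cS.
have kL : k \in L := fintype.subsetP SL k kS.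
pose E j := (\int[P]_w (f j (X j w))%:E)%E.
have E0 j : (0 <= E j)%E by apply: integral_ge0 => w _; rewrite lee_fin.
have EF j : E j \is a fin_num by rewrite ge0_fin_numE; [exact: fi|exact: E0].
pose g w := \prod_(j in L :\ k) f j (X j w).
have g0 w : 0 <= g w by apply: prodr_ge0.
have mg : measurable_fun setT g.
  exact: mprod.
pose c := \prod_(j in L :\ k) fine (E j).
have c0 : 0 <= c by apply: prodr_ge0 => j _; rewrite fine_ge0.
have cE : c%:E = (\prod_(j in L :\ k) E j)%E.
  rewrite /c; elim/big_rec2: _ => // j y1 y2 _ <-.
  by rewrite EFinM fineK.
(* The law of [X k], scaled by the product of the other expectations. The induction hypothesis, with
   an indicator put at [k], says that it is also the image under [X k] of the measure with density
   [g]. *)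
pose nu := mscale (NngNum c0) (distribution P (X k)).
have nuE A : measurable A -> nu A = (\int[P]_x (g x * \1_A (X k x))%:E)%E.
  move=> mA; rewrite /nu /mscale /= /distribution /pushforward.
  pose f' j := if j == k then \1_A else f j.
  pose B' j := if j == k then A else B j.
  have mAk : measurable (X k @^-1` A) by rewrite -[X in measurable X]setTI; exact: mX.
  have fk (j : K) : j != k -> f' j = f j by rewrite /f' => /negbTE ->.
  have := IH (S :\ k) f' B'; rewrite (bigD1 k)//=.
  have -> : (\int[P]_w (f' k (X k w))%:E)%E = P (X k @^-1` A).
    by rewrite -[in RHS](setIT (_ @^-1` _)) -integral_indic// /f' eqxx.
  have -> : (\prod_(i in L | i != k) \int[P]_w (f' i (X i w))%:E)%E = c%:E.
    rewrite cE; apply: eq_big => j; first by rewrite !inE andbC.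
    by move=> /andP[_ jk]; rewrite /E fk.
  move=> IHk; rewrite muleC -IHk; first last.
  - move=> j; rewrite !inE /f' /B'; case: eqP => [->//|_] /=.
    by move=> h; apply: fB; rewrite inE.
  - by move=> j; rewrite /B'; case: eqP.
  - move=> j; have [->|jk] := eqVneq j k; last by rewrite fk.
    rewrite /f' eqxx integral_indic// setIT.
    by rewrite (le_lt_trans (probability_le1 P mAk))// ltry.
  - move=> j y; rewrite /f'; case: eqP => // _; exact: f0.
  - by move=> j; rewrite /f'; case: eqP => // _; exact: measurable_indic.
  - by apply: fintype.subset_trans SL; exact: subsetDl.
  - by have := cardsD1 k S; rewrite kS cS => -[].
  apply: eq_integral => w _; congr EFin; rewrite (bigD1 k)//= mulrC; congr (_ * _).
    apply: eq_big => j; first by rewrite !inE andbC.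
    by move=> /andP[_ jk]; rewrite fk.
  by rewrite /f' eqxx.
have := @ge0_integral_density _ _ _ _ _ P nu g (X k) mg g0 (mX k) nuE _ (mf k) (f0 k).
have mfk : measurable_fun setT (EFin \o f k) by exact/measurable_EFinP.
rewrite /nu ge0_integral_mscale//; last by move=> y _; rewrite lee_fin.
rewrite ge0_integral_distribution//; last by move=> y; rewrite lee_fin.
move=> kE.
rewrite [RHS](bigD1 k)//= [X in (_ * X)%E](_ : _ = c%:E); last first.
  by rewrite cE; apply: eq_bigl => j; rewrite !inE andbC.
rewrite muleC kE; apply: eq_integral => w _; congr EFin.
rewrite (bigD1 k)//= mulrC; congr (_ * _).
by apply: eq_bigl => j; rewrite !inE andbC.
Qed.

(** [S] contains the indices whose factor has unknown sign. Both sides are linear in each factor, so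
    at one index of [S] the function is written as the difference of the nonnegative functions
    [f + |f|] and [|f|]. *)
Let indep_signed n (S L : {set K}) (f : K -> R -> R) :
  L \subset J -> #|S| = n -> S \subset L ->
  (forall k, measurable_fun setT (f k)) ->
  (forall k, P.-integrable setT (EFin \o (fun w => f k (X k w)))) ->
  (forall k y, k \in ~: S -> 0 <= f k y) ->
  P.-integrable setT (EFin \o (fun w => \prod_(k in L) f k (X k w))) /\
  \int[P]_w (\prod_(k in L) f k (X k w)) =
    \prod_(k in L) \int[P]_w (f k (X k w)).
Proof.
move=> LJ; elim: n S f => [|n IH] S f cS SL mf fi fS.
  have S0 : S = finset.set0 by apply/eqP; rewrite -cards_eq0 cS.
  have f0 k y : 0 <= f k y by apply: fS; rewrite S0 finset.setC0 inE.
  have fin k : (\int[P]_w (f k (X k w))%:E)%E \is a fin_num.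
    exact: integrable_fin_num (fi k).
  have E : (\int[P]_w (\prod_(k in L) f k (X k w))%:E =
      \prod_(k in L) \int[P]_w (f k (X k w))%:E)%E.
    (* All of [L] is to be treated, so no factor has to be an indicator and the sets are
       arbitrary. *)
    apply: (@ge0_indep #|L| L L f (fun=> set0)) => //.
    - by move=> k; rewrite ltey_eq fin.
    - by move=> k; rewrite finset.setDv inE.
  have E' : (\int[P]_w (\prod_(k in L) f k (X k w))%:E =
      (\prod_(k in L) \int[P]_w (f k (X k w)))%:E)%E.
    rewrite E; elim/big_rec2: _ => // k y1 y2 _ ->.
    by rewrite EFinM /Rintegral fineK.
  split; last by rewrite /Rintegral E'.
  apply/integrableP; split; first by apply/measurable_EFinP; exact: mprod.
  under eq_integral do rewrite /= ger0_norm ?prodr_ge0//.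
  by rewrite E' ltry.
have [k kS] : exists k, k \in S by apply/fintype.card_gt0P; rewrite cS.
have kL : k \in L := fintype.subsetP SL k kS.
pose fa j := if j == k then (fun y => f j y + `|f j y|) else f j.
pose fb j := if j == k then (fun y => `|f j y|) else f j.
have IHab g : (forall j, j != k -> g j = f j) -> (forall y, 0 <= g k y) ->
    measurable_fun setT (g k) ->
    P.-integrable setT (EFin \o (fun w => g k (X k w))) ->
  P.-integrable setT (EFin \o (fun w => \prod_(k in L) g k (X k w))) /\
  \int[P]_w (\prod_(k in L) g k (X k w)) =
    \prod_(k in L) \int[P]_w (g k (X k w)).
  move=> gE g0 mg ig; apply: (IH (S :\ k)).
  - by have := cardsD1 k S; rewrite kS cS => -[].
  - by apply: fintype.subset_trans SL; exact: subsetDl.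
  - by move=> j; have [->//|/gE ->] := eqVneq j k.
  - by move=> j; have [->//|/gE ->] := eqVneq j k.
  - move=> j y; have [->//|jk] := eqVneq j k; rewrite gE// !inE jk/= => jS.
    by apply: fS; rewrite inE.
have ik := fi k.
have mk : measurable_fun setT (fun y => `|f k y|) by exact: measurableT_comp.
have iabs : P.-integrable setT (EFin \o (fun w => `|f k (X k w)|)).
  exact: integrable_abse ik.
have [ia Ea] : P.-integrable setT (EFin \o (fun w => \prod_(k in L) fa k (X k w))) /\
  \int[P]_w (\prod_(k in L) fa k (X k w)) =
    \prod_(k in L) \int[P]_w (fa k (X k w)).
  apply: IHab => [j /negbTE|y||]; rewrite /fa ?eqxx.
  - by move=> ->.
  - by rewrite -lerBlDl sub0r -normrN ler_norm.
  - exact: measurable_funD.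
  - have := @integrableD _ _ _ P setT measurableT _ _ ik iabs.
    exact: eq_integrable.
have [ib Eb] : P.-integrable setT (EFin \o (fun w => \prod_(k in L) fb k (X k w))) /\
  \int[P]_w (\prod_(k in L) fb k (X k w)) =
    \prod_(k in L) \int[P]_w (fb k (X k w)).
  by apply: IHab => [j /negbTE|y||]; rewrite /fb ?eqxx// => ->.
have E : (fun w => \prod_(j in L) f j (X j w)) =
    (fun w => \prod_(j in L) fa j (X j w) - \prod_(j in L) fb j (X j w)).
  apply/funext => w; rewrite !(bigD1 k kL)/= /fa /fb !eqxx.
  rewrite [in X in _ = (_ + _) * X - _](eq_bigr (fun j => f j (X j w))); last first.
    by move=> j /andP[_ /negbTE ->].
  rewrite [in X in _ = _ - _ * X](eq_bigr (fun j => f j (X j w))); last first.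
    by move=> j /andP[_ /negbTE ->].
  by rewrite -mulrBl addrK.
split.
  rewrite E; have := @integrableB _ _ _ P setT measurableT _ _ ia ib.
  exact: eq_integrable.
rewrite E RintegralB// Ea Eb !(bigD1 k kL)/= /fa /fb !eqxx.
rewrite [in X in (_ * X) - _](eq_bigr (fun j => \int[P]_w f j (X j w))); last first.
  by move=> j /andP[_ /negbTE ->].
rewrite [in X in _ - (_ * X)](eq_bigr (fun j => \int[P]_w f j (X j w))); last first.
  by move=> j /andP[_ /negbTE ->].
by rewrite -mulrBl RintegralD// addrK.
Qed.

Lemma indep_Rintegral_prod (L : {set K}) (f : K -> R -> R) :
  L \subset J -> (forall k, measurable_fun setT (f k)) ->
  (forall k, P.-integrable setT (EFin \o (fun w => f k (X k w)))) ->
  P.-integrable setT (EFin \o (fun w => \prod_(k in L) f k (X k w))) /\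
  \int[P]_w (\prod_(k in L) f k (X k w)) =
    \prod_(k in L) \int[P]_w (f k (X k w)).
Proof.
(* [indep_signed] wants nonnegative functions off [L] as well; there they are replaced by 0, which
   changes neither product. *)
move=> LJ mf fi; pose f' k := if k \in L then f k else cst 0.
have := @indep_signed #|L| L L f' LJ erefl.
rewrite (_ : (fun w => \prod_(k in L) f' k (X k w)) =
             (fun w => \prod_(k in L) f k (X k w))); last first.
  by apply/funext => w; apply: eq_bigr => k kL; rewrite /f' kL.
rewrite (_ : \prod_(k in L) \int[P]_w f' k (X k w) =
             \prod_(k in L) \int[P]_w f k (X k w)); last first.
  by apply: eq_bigr => k kL; rewrite /f' kL.
apply => //.
- by move=> k; rewrite /f'; case: ifP.
- move=> k; rewrite /f'; case: ifP => // _.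
  exact: integrable0.
- by move=> k y; rewrite inE /f' => /negbTE ->.
Qed.

End Independence.

(** * Moments of a centered Gaussian variable *)

Section GaussianMoments.
Local Open Scope classical_set_scope.
Variables (R : realType) (s : R).
Hypothesis s0 : s != 0.
Local Notation mu := (@lebesgue_measure R).
Local Notation phi := (normal_pdf 0 s).

Let s2 : 0 < s ^+ 2. Proof. by rewrite exprn_even_gt0. Qed.

Let c : R := (s ^+ 2 *+ 2)^-1.

Let c0 : 0 < c. Proof. by rewrite invr_gt0 mulrn_wgt0. Qed.

Let phiE x : phi x = normal_peak s * expR (- c * x ^+ 2).
Proof.
by rewrite normal_pdfE// /normal_fun subr0; congr (_ * expR _); rewrite !mulNr mulrC.
Qed.

Let s' : R := s * Num.sqrt 2.

Let s'0 : s' != 0.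
Proof. by rewrite mulf_neq0// gt_eqF// sqrtr_gt0. Qed.

Let psiE x : normal_pdf 0 s' x = normal_peak s' * expR (- (c / 2) * x ^+ 2).
Proof.
rewrite normal_pdfE// /normal_fun subr0 exprMn sqr_sqrtr//.
congr (_ * expR _); rewrite !mulNr; congr (- _); rewrite mulrC; congr (_ * _).
by rewrite /c -invfM -mulr_natr -[in RHS]mulr_natr.
Qed.

(* The Gaussian of twice the variance absorbs the polynomial factor. *)
Lemma normal_pdf_poly_ub n : exists2 C, 0 <= C &
  forall x, `|x ^+ n * phi x| <= C * normal_pdf 0 s' x.
Proof.
(* With y = c x^2 / 2, the factor |x|^n is at most 1 + (c/2)^-(n+1) y^(n+1), and y^(n+1) <= (n+1)!
   e^y by the exponential series; [D] bounds |x|^n e^(-y). *)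
pose D : R := 1 + (c / 2) ^- n.+1 * n.+1`!%:R.
have D0 : 0 <= D.
  by rewrite addr_ge0// mulr_ge0// invr_ge0 exprn_ge0// divr_ge0// ltW.
have pk : 0 < normal_peak s' by exact: normal_peak_gt0.
exists (D * normal_peak s / normal_peak s').
  by rewrite mulr_ge0 ?invr_ge0 ?mulr_ge0 ?normal_peak_ge0// ltW.
move=> x; rewrite phiE psiE normrM normrX.
rewrite (ger0_norm (mulr_ge0 (normal_peak_ge0 _) (expR_ge0 _))).
rewrite [leRHS]mulrA (divfK (lt0r_neq0 pk)).
rewrite (_ : - c * x ^+ 2 = - (c / 2) * x ^+ 2 - (c / 2) * x ^+ 2); last first.
  by field.
rewrite expRD.
rewrite [leLHS](_ : _ = normal_peak s * (expR (- (c / 2) * x ^+ 2) *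
  (`|x| ^+ n * expR (- (c / 2 * x ^+ 2))))); last by ring.
rewrite [leRHS](_ : _ = normal_peak s * (expR (- (c / 2) * x ^+ 2) * D)); last by ring.
rewrite !ler_wpM2l ?normal_peak_ge0 ?expR_ge0//.
rewrite expRN ler_pdivrMr ?expR_gt0//.
set y := c / 2 * x ^+ 2.
have y0 : 0 <= y by rewrite mulr_ge0 ?sqr_ge0// divr_ge0// ltW.
have e1 : 1 <= expR y by rewrite -expR0 ler_expR.
have e2 : y ^+ n.+1 <= n.+1`!%:R * expR y.
  rewrite -ler_pdivrMl ?ltr0n ?fact_gt0//.
  apply: le_trans (expR_ge1Dxn n y0).
  by rewrite mulrC ler_wpDl.
have xn : `|x| ^+ n <= 1 + (x ^+ 2) ^+ n.+1.
  have [x1|x1] := leP `|x| 1.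
    apply: (le_trans (exprn_ile1 _ (normr_ge0 x) x1)).
    by rewrite lerDl exprn_ge0// sqr_ge0.
  rewrite -real_normK ?num_real// -exprM (@le_trans _ _ (`|x| ^+ (2 * n.+1)))//.
    by rewrite ler_eXn2l// (leq_trans (leqnSn n))// leq_pmull.
  by rewrite lerDr.
apply: (le_trans xn); rewrite mulrDl mul1r lerD//.
rewrite -mulrA -ler_pdivrMl.
  by rewrite invrK -exprMn.
by rewrite invr_gt0 exprn_gt0// divr_gt0.
Qed.

Let mpoly n : measurable_fun [set: R] (fun x : R => x ^+ n * phi x).
Proof. by apply: measurable_funM => //; exact: measurable_normal_pdf. Qed.

Lemma integrable_normal_pdf_poly n :
  mu.-integrable setT (EFin \o (fun x => x ^+ n * phi x)).
Proof.
have [C C0 H] := normal_pdf_poly_ub n.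
have := integrableZl measurableT C (integrable_normal_pdf 0 s').
apply: le_integrable => //.
  by apply/measurable_EFinP; apply: mpoly.
move=> x _; rewrite lee_fin [leRHS]ger0_norm ?mulr_ge0 ?normal_pdf_ge0//.
Qed.

(** The moment recursion is the statement that the derivative [f n] of [F n] has integral 0. For n =
    0 the truncated [n.-1] is multiplied by 0. *)
Let F n (x : R) : R := x ^+ n * phi x.
Let f n (x : R) : R := n%:R * F n.-1 x - F n.+1 x / s ^+ 2.

Let dF n (x : R) : is_derive x 1 (F n) (f n x).
Proof.
have H1 k (y : R) : is_derive y 1 (fun y : R => y ^+ k) (k%:R * y ^+ k.-1).
  have := is_deriveX k (is_derive_id y 1).
  rewrite (_ : id ^+ k = (fun y : R => y ^+ k)) /=; last first.
    by apply/funext => z; rewrite exprfctE.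
  by rewrite -[_ *: _]/(_ * _) mulr1.
have H2 : is_derive x 1 phi (- x / s ^+ 2 * phi x).
  have e1 : is_derive x 1 (fun y : R => - c * y ^+ 2) (- c * (2 * x)).
    by have := is_deriveZ (- c) (H1 2 x); rewrite expr1.
  have := is_deriveZ (normal_peak s) (is_derive1_comp (is_derive_expR _) e1).
  rewrite (_ : _ \*: _ = phi); last by apply/funext => y; rewrite /= phiE.
  rewrite phiE => /is_derive_eq; apply.
  rewrite -[LHS]/(_ * (_ * _)) /c mulNr -[s ^+ 2 *+ 2]mulr_natr.
  by field.
have := is_deriveM (H1 n x) H2.
rewrite (_ : (fun y : R => y ^+ n) * phi = F n); last by apply/funext.
move=> /is_derive_eq; apply; rewrite /f /F.
rewrite -[_ *: _]/(_ * _) -[X in _ + X]/(_ * _) (exprS x n).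
by field.
Qed.

Let cF n : continuous (F n).
Proof.
by move=> x; apply: cvgM; [exact: exprn_continuous|exact: continuous_normal_pdf].
Qed.

Let cf n : continuous (f n).
Proof.
move=> x; apply: cvgB; first by apply: cvgMl_tmp; exact: cF.
by apply: cvgM; [exact: cF|exact: cvg_cst].
Qed.

Let If n : mu.-integrable setT (EFin \o f n).
Proof.
have h1 := integrableZl measurableT n%:R (integrable_normal_pdf_poly n.-1).
have h2 := integrableZl measurableT (s ^- 2) (integrable_normal_pdf_poly n.+1).
have := integrableB measurableT h1 h2; apply: eq_integrable => // x _ /=.
by rewrite /f /F -!EFinM -EFinB; congr (_ - _)%:E; rewrite mulrC.
Qed.

(** The boundary terms of the integration by parts: the polynomial bound in degree n+1 makes x F(x)
    bounded, so F is O(1/m) at both ends. *)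
Let cvgF n : (F n m.+1%:R - F n (- m.+1%:R)) @[m --> \oo] --> (0:R).
Proof.
have [C C0 H] := normal_pdf_poly_ub n.+1.
pose B := C * normal_peak s'.
have FB (x : R) : `|x| * `|F n x| <= B.
  rewrite /F -normrM mulrA -exprS; apply: (le_trans (H x)).
  by rewrite ler_wpM2l// normal_pdf_ub.
have FB' m (x : R) : `|x| = m.+1%:R -> `|F n x| <= B * m.+1%:R^-1.
  by move=> xm; rewrite ler_pdivlMr ?ltr0n// mulrC -xm FB.
have h : (2 * B * m.+1%:R^-1) @[m --> \oo] --> (0:R).
  rewrite -(mulr0 (2 * B)); apply: cvgMl_tmp; exact: cvg_harmonic.
apply: (@squeeze_cvgr _ _ _ _ (fun m : nat => - (2 * B * m.+1%:R^-1))
  (fun m : nat => 2 * B * m.+1%:R^-1)) => //.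
  apply: nearW => m; rewrite -ler_norml (le_trans (ler_normB _ _))//.
  rewrite (_ : 2 * B / m.+1%:R = B / m.+1%:R + B / m.+1%:R); last by field.
  by rewrite lerD// FB'// ?normrN normr_nat//.
by rewrite -oppr0; apply: cvgN.
Qed.

Let D (m : nat) : set R := `[- m.+1%:R, m.+1%:R].

Let intf n m : (\int[mu]_(x in D m) (f n x)%:E)%E =
  (F n m.+1%:R - F n (- m.+1%:R))%:E.
Proof.
rewrite (@continuous_FTC2 _ (f n) (F n))//.
- by rewrite (@lt_trans _ _ 0)// ?oppr_lt0 ltr0n.
- by apply: continuous_subspaceT => x; exact: cf.
- split; first by move=> x _; have [] := dF n x.
  + by apply: cvg_at_right_filter; exact: cF.
  + by apply: cvg_at_left_filter; exact: cF.
- by move=> x _; rewrite derive1E; have [_ ->] := dF n x.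
Qed.

(** The fundamental theorem of calculus on the intervals [D m] leaves the boundary terms, which tend
    to 0; dominated convergence, with |f n| as bound, identifies the limit with the integral over
    the line. *)
Let intf0 n : (\int[mu]_x (f n x)%:E)%E = 0%E.
Proof.
pose f_ (m : nat) := (EFin \o f n) \_ (D m).
have mfn : measurable_fun [set: R] (EFin \o f n) by exact: measurable_int (If n).
have mf_ m : measurable_fun setT (f_ m).
  apply/(measurable_restrictT _ _).1; first exact: measurable_itv.
  exact: measurable_funTS.
have f_f : {ae mu, forall x, setT x -> f_ ^~ x @ \oo --> (EFin \o f n) x}.
  apply: aeW => x _; apply: cvg_near_cst; near=> m.
  rewrite /f_ patchE mem_set// /D /= in_itv /= -ler_norml.
  rewrite (@le_trans _ _ m%:R)// ?ler_nat//.
  by near: m; exact: nbhs_infty_ger.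
have f_le : {ae mu, forall x m, setT x -> (`|f_ m x| <= (abse \o (EFin \o f n)) x)%E}.
  apply: aeW => x m _; rewrite /f_ patchE; case: ifP => //= _.
  by rewrite normr0 lee_fin.
have [_ _] := @dominated_convergence _ _ _ mu setT measurableT f_ (EFin \o f n)
  (abse \o (EFin \o f n)) mf_ mfn f_f (integrable_abse (If n)) f_le.
move=> H.
have : (fun m => (\int[mu]_x f_ m x)%E) @ \oo --> (0%:E : \bar R).
  rewrite (_ : (fun m => _) = EFin \o (fun m => F n m.+1%:R - F n (- m.+1%:R))).
    by apply: cvg_EFin; [exact: nearW|exact: cvgF].
  by apply/funext => m; rewrite -[LHS]integral_mkcond intf.
by move: H => /cvg_unique H /H; exact.
Unshelve. all: by end_near. Qed.

Lemma normal_pdf_moment_rec n :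
  \int[mu]_x (x ^+ n.+1 * phi x) = s ^+ 2 * n%:R * \int[mu]_x (x ^+ n.-1 * phi x).
Proof.
have h1 := integrable_normal_pdf_poly n.-1.
have h2 := integrable_normal_pdf_poly n.+1.
have : \int[mu]_x (f n x) = 0 by rewrite /Rintegral intf0.
have h1' : mu.-integrable setT (EFin \o (fun x => n%:R * F n.-1 x)).
  exact: (integrableZl measurableT n%:R h1).
have h2' : mu.-integrable setT (EFin \o (fun x => F n.+1 x / s ^+ 2)).
  have := integrableZl measurableT (s ^- 2) h2; apply: eq_integrable => // x _ /=.
  by rewrite -EFinM mulrC.
rewrite RintegralB// RintegralZl// RintegralZr// => /eqP; rewrite subr_eq0 => /eqP H.
rewrite -[RHS]mulrA H mulrC divfK//; exact: lt0r_neq0.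
Qed.

End GaussianMoments.

Section GaussianVariable.
Local Open Scope classical_set_scope.
Context d (T : measurableType d) (R : realType) (P : probability T R).
Variables (Y : {RV P >-> R}) (s : R).
Hypothesis s0 : s != 0.
Hypothesis YE : forall B, measurable B -> distribution P Y B = normal_prob 0 s B.

Let YN (f : R -> R) : measurable_fun setT f -> (forall x, 0 <= f x) ->
  (\int[P]_w (f (Y w))%:E = \int[lebesgue_measure]_x (f x * normal_pdf 0 s x)%:E)%E.
Proof.
move=> mf f0.
have mf' : measurable_fun setT (EFin \o f) by exact/measurable_EFinP.
rewrite -(@ge0_integral_distribution _ _ _ _ _ P Y (EFin \o f))//.
under [RHS]eq_integral do rewrite mulrC.
have := @ge0_integral_density _ _ _ _ _ (@lebesgue_measure R)
  (distribution P Y) (normal_pdf 0 s) id (measurable_normal_pdf _ _)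
  (normal_pdf_ge0 _ _) (@measurable_id _ _ _) _ f mf f0.
move=> H; apply: H => B mB; rewrite [LHS](YE mB).
rewrite (_ : (fun x => _) = (fun x => (normal_pdf 0 s x)%:E) \_ B).
  exact: integral_mkcond.
apply/funext => x.
by rewrite patchE indicE; case: ifP => _; rewrite ?mulr1 ?mulr0.
Qed.

Let mX n : measurable_fun [set: R] (fun x : R => x ^+ n).
Proof. exact: measurable_funX. Qed.

Lemma integrable_gaussian_pow n : P.-integrable setT (EFin \o (fun w => Y w ^+ n)).
Proof.
apply/integrableP; split.
  by apply/measurable_EFinP; apply: measurable_funX; exact: measurable_funP.
have /integrableP[_] := integrable_normal_pdf_poly s0 n.
apply: le_lt_trans; rewrite (YN (f := fun x => `|x ^+ n|))//; last first.
  exact: measurableT_comp.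
under [leRHS]eq_integral do rewrite /= normrM (ger0_norm (normal_pdf_ge0 _ _ _)).
by [].
Qed.

(** The change of variables [YN] is for nonnegative functions only; it is applied to |x^n| and to
    x^n + |x^n|, and the results are subtracted. *)
Lemma gaussian_powE n :
  \int[P]_w (Y w ^+ n) = \int[lebesgue_measure]_x (x ^+ n * normal_pdf 0 s x).
Proof.
have iP := integrable_gaussian_pow n.
have iPa : P.-integrable setT (EFin \o (fun w => `|Y w ^+ n|)) := integrable_abse iP.
have iL := integrable_normal_pdf_poly s0 n.
have iLa : lebesgue_measure.-integrable setT
    (EFin \o (fun x => `|x ^+ n| * normal_pdf 0 s x)).
  apply: eq_integrable (integrable_abse iL) => // x _ /=.
  by rewrite normrM (ger0_norm (normal_pdf_ge0 _ _ _)).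
have mabs : measurable_fun [set: R] (fun x : R => `|x ^+ n|) by exact: measurableT_comp.
have Ea : \int[P]_w `|Y w ^+ n| =
    \int[lebesgue_measure]_x (`|x ^+ n| * normal_pdf 0 s x).
  by rewrite /Rintegral (YN (f := fun x => `|x ^+ n|)).
have Es : \int[P]_w (Y w ^+ n + `|Y w ^+ n|) =
    \int[lebesgue_measure]_x (x ^+ n * normal_pdf 0 s x + `|x ^+ n| * normal_pdf 0 s x).
  under [RHS]eq_Rintegral do rewrite -mulrDl.
  rewrite /Rintegral (YN (f := fun x => x ^+ n + `|x ^+ n|))//.
    exact: measurable_funD.
  by move=> x; rewrite -lerBlDl sub0r -normrN ler_norm.
by move: Es; rewrite !RintegralD// Ea => /addIr.
Qed.

Lemma gaussian_moment_rec n :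
  \int[P]_w (Y w ^+ n.+1) = s ^+ 2 * n%:R * \int[P]_w (Y w ^+ n.-1).
Proof. by rewrite !gaussian_powE normal_pdf_moment_rec. Qed.

End GaussianVariable.

(** * Wick recursion for monomials in independent Gaussian variables *)

Section Wick.
Local Open Scope classical_set_scope.
Context d (T : measurableType d) (R : realType) (P : probability T R).
Variables (K : finType) (J : {set K}) (X : K -> {RV P >-> R}) (s : K -> R).
Hypothesis indep : mutually_independent J X.
Hypothesis s0 : forall k, s k != 0.
Hypothesis XE : forall k B, measurable B ->
  distribution P (X k) B = normal_prob 0 (s k) B.
Variables (V : finType) (t : V -> K).
Hypothesis tJ : forall v, t v \in J.

Let mult (S : {set V}) k : nat := #|[pred v in S | t v == k]|.

Let monomialE (S : {set V}) w :
  \prod_(v in S) X (t v) w = \prod_(k in J) X k w ^+ mult S k.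
Proof.
rewrite (partition_big t (mem J))//=; apply: eq_bigr => k kJ.
rewrite -prodr_const; apply: eq_bigr => v /andP[_ /eqP ->] //.
Qed.

Lemma integrable_monomial (S : {set V}) :
  P.-integrable setT (EFin \o (fun w => \prod_(v in S) X (t v) w)).
Proof.
have [+ _] := indep_Rintegral_prod (f := fun k x => x ^+ mult S k) indep
  (fintype.subxx J) (fun k => measurable_funX _ (@measurable_id _ _ _))
  (fun k => integrable_gaussian_pow (s0 k) (XE k) (mult S k)).
by apply: eq_integrable => // w _; rewrite /= monomialE.
Qed.

Let monomialI (S : {set V}) : \int[P]_w (\prod_(v in S) X (t v) w) =
  \prod_(k in J) \int[P]_w (X k w ^+ mult S k).
Proof.
have [_] := indep_Rintegral_prod (f := fun k x => x ^+ mult S k) indep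
  (fintype.subxx J) (fun k => measurable_funX _ (@measurable_id _ _ _))
  (fun k => integrable_gaussian_pow (s0 k) (XE k) (mult S k)).
by move=> <-; apply: eq_Rintegral => w _; rewrite monomialE.
Qed.

Let multD1 (S : {set V}) u k : u \in S ->
  mult S k = ((t u == k) + mult (S :\ u) k)%N.
Proof.
move=> uS; rewrite /mult (cardD1 u) inE/= uS /=; congr addn.
by apply: eq_card => v; rewrite !inE andbA.
Qed.

(** By independence only the power of [X (t u)] matters. Its moment recursion has the factor n, the
    number of other v in [S] with t v = t u; writing n as a sum over these v gives one pairing of
    [u] per term. *)
Lemma wick_rec (S : {set V}) u : u \in S ->
  \int[P]_w (\prod_(v in S) X (t v) w) =
  \sum_(v in S :\ u) (if t v == t u then s (t u) ^+ 2 else 0) *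
    \int[P]_w (\prod_(z in S :\ u :\ v) X (t z) w).
Proof.
move=> uS; set k0 := t u.
pose A := \prod_(k in J | k != k0) \int[P]_w (X k w ^+ mult S k).
have k0J : k0 \in J by exact: tJ.
rewrite monomialI (bigD1 k0)//= -/A (multD1 _ uS) eqxx add1n.
rewrite (gaussian_moment_rec (s0 k0) (XE k0)).
rewrite (bigID (fun v => t v == k0))/= [X in _ = _ + X]big1 ?addr0; last first.
  by move=> v /andP[_ /negbTE ->]; rewrite mul0r.
rewrite (eq_bigr (fun=> s k0 ^+ 2 * (\int[P]_w (X k0 w ^+ (mult (S :\ u) k0).-1) * A))).
  rewrite (eq_bigl (mem [pred v in S :\ u | t v == k0]))//.
  rewrite sumr_const -/(mult (S :\ u) k0) -[RHS]mulr_natr.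
  by ring.
move=> v /andP[vS vk]; rewrite vk; congr (_ * _).
rewrite monomialI (bigD1 k0)//= (multD1 k0 vS) vk add1n; congr (_ * _).
apply: eq_bigr => k /andP[_ kk0].
rewrite (multD1 k uS) (multD1 k vS) (eqP vk) -/k0 (eq_sym k0) (negbTE kk0).
by rewrite !add0n.
Qed.

End Wick.

(** * Connectivity along a list of pairs *)

(** On [A], [G] factors through [F]. Numbers of classes for different relations are compared in this
    way, without building maps between sets of classes. [Some] supplies the default value for points
    outside the image of [F]. *)
Lemma leq_card_kernel (T U U' : finType) (A : {set T}) (F : T -> U) (G : T -> U') :
  {in A &, forall x y, F x = F y -> G x = G y} -> (#|G @: A| <= #|F @: A|)%N.
Proof.
move=> FG; rewrite -(card_imset (mem (G @: A)) (@Some_inj _)).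
pose r u := if [pick x in A | F x == u] is Some x then Some (G x) else None.
rewrite (leq_trans _ (leq_imset_card r (mem (F @: A))))//; apply: subset_leq_card.
apply/fintype.subsetP => _ /imsetP[_ /imsetP[x xA ->] ->].
apply/imsetP; exists (F x); first exact: imset_f.
rewrite /r; case: pickP => [y /andP[yA /eqP yx]|/(_ x)]; last by rewrite xA eqxx.
by congr Some; apply: FG.
Qed.

Lemma eq_card_kernel (T U U' : finType) (A : {set T}) (F : T -> U) (G : T -> U') :
  {in A &, forall x y, F x = F y <-> G x = G y} -> #|G @: A| = #|F @: A|.
Proof.
move=> FG; apply/eqP; rewrite eqn_leq.
by apply/andP; split; apply: leq_card_kernel => x y xA yA /FG; exact.
Qed.

Lemma connect_min (T : finType) (e Q : rel T) :
  reflexive Q -> transitive Q -> subrel e Q -> subrel (connect e) Q.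
Proof.
move=> Qr Qt eQ x _ /connectP[s + ->].
elim: s x => [|y s IH] x /=; first by move=> _; exact: Qr.
by move=> /andP[/eQ xy /IH]; exact: Qt.
Qed.

Lemma class_eqP (T : finType) (e : rel T) : connect_sym e -> forall x y,
  [set z | connect e x z] = [set z | connect e y z] <-> connect e x y.
Proof.
move=> es x y; split.
  by move=> /(congr1 (fun A : {set T} => y \in A)); rewrite !inE connect0.
by move=> xy; apply/setP => z; rewrite !inE; exact: (same_connect es).
Qed.

Section PairRelation.
Variable H : finType.
Implicit Types (E : seq (H * H)) (a b x y z : H).

Definition pair_rel E : rel H :=
  [rel x y | ((x, y) \in E) || ((y, x) \in E)].

Definition conn E : rel H := connect (pair_rel E).

Definition ncc E : nat := #|components (pair_rel E)|.

Lemma conn_refl E x : conn E x x. Proof. exact: connect0. Qed.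

Lemma conn_sym E : connect_sym (pair_rel E).
Proof. by apply: sym_connect_sym => x y; rewrite /pair_rel /= orbC. Qed.

Lemma connC E x y : conn E x y = conn E y x.
Proof. exact: conn_sym. Qed.

Lemma conn_trans E : transitive (conn E).
Proof. exact: connect_trans. Qed.

Lemma conn1 E x y : (x, y) \in E -> conn E x y.
Proof. by move=> xy; apply: connect1; rewrite /pair_rel /= xy. Qed.

Lemma conn_sub E1 E2 : {in E1, forall e, conn E2 e.1 e.2} ->
  subrel (conn E1) (conn E2).
Proof.
move=> h; apply: connect_sub => x y /orP[/h //|/h].
by rewrite connC.
Qed.

Lemma conn_subset E1 E2 : {subset E1 <= E2} -> subrel (conn E1) (conn E2).
Proof. by move=> h; apply: conn_sub => -[x y] /h; exact: conn1. Qed.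

Lemma ncc_sub E1 E2 : subrel (conn E1) (conn E2) -> (ncc E2 <= ncc E1)%N.
Proof.
move=> h; apply: leq_card_kernel => x y _ _.
by move=> /(class_eqP (conn_sym E1))/h/(class_eqP (conn_sym E2)).
Qed.

(** One more pair merges the classes of [a] and [b] and does nothing else: the right-hand side is
    already reflexive, transitive and contains all the pairs. *)
Lemma conn_cons E a b x y : conn ((a, b) :: E) x y =
  conn E x y || ((conn E a x || conn E b x) && (conn E a y || conn E b y)).
Proof.
apply/idP/idP; last first.
  have sub : subrel (conn E) (conn ((a, b) :: E)).
    by apply: conn_subset => z zE; rewrite inE zE orbT.
  have ab : conn ((a, b) :: E) a b by apply: conn1; rewrite mem_head.
  have am z : conn E a z || conn E b z -> conn ((a, b) :: E) a z.
    by move=> /orP[/sub//|/sub]; exact: conn_trans.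
  move=> /orP[/sub//|/andP[/am ax /am ay]].
  by apply: conn_trans ay; rewrite connC.
move: x y; pose Q : rel H := fun x y => conn E x y ||
  ((conn E a x || conn E b x) && (conn E a y || conn E b y)).
have Qs x y : Q x y -> Q y x.
  by rewrite /Q /conn (conn_sym E) => /orP[->//|/andP[-> ->]]; rewrite orbT.
have mem x y : conn E x y -> conn E a x || conn E b x -> conn E a y || conn E b y.
  by move=> xy /orP[|] h; rewrite (conn_trans h xy) ?orbT.
apply: (@connect_min _ _ Q).
- by move=> x; rewrite /Q conn_refl.
- move=> y x z /orP[xy|/andP[x1 y1]] /orP[yz|/andP[y2 z2]]; apply/orP.
  + by left; exact: conn_trans xy yz.
  + right; rewrite z2 andbT; apply: mem y2.
    by rewrite connC.
  + by right; rewrite x1 /=; exact: mem yz y1.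
  + by right; rewrite x1.
- have h x y : (x, y) \in (a, b) :: E -> Q x y.
    rewrite inE => /orP[/eqP[-> ->]|/conn1 xy]; rewrite /Q ?xy// !conn_refl !orbT.
    done.
  by move=> x y /orP[/h //|/h/Qs].
Qed.

(** Put the class of [b] aside. Among the points outside it, the new pair connects nothing that was
    not connected before. *)
Lemma ncc_cons E a b : (ncc E <= (ncc ((a, b) :: E)).+1)%N.
Proof.
pose F x := [set z | conn E x z].
pose A := [set x | ~~ conn E b x].
have sub : F @: [set: H] \subset F b |: (F @: A).
  apply/fintype.subsetP => _ /imsetP[x _ ->]; rewrite in_setU1.
  have [bx|bx] := boolP (conn E b x).
    by apply/orP; left; apply/eqP/(class_eqP (conn_sym E)); rewrite conn_sym.
  by rewrite imset_f ?orbT// inE.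
rewrite (leq_trans (subset_leq_card sub))// cardsU1 -add1n leq_add//.
  by case: (_ \notin _).
apply: (@leq_trans #|[set [set z | conn ((a, b) :: E) x z] | x in A]|).
  apply: leq_card_kernel => x y; rewrite !inE => xA yA.
  move=> /(class_eqP (conn_sym _)); rewrite -/(conn _ _ _) conn_cons.
  rewrite (negbTE xA) (negbTE yA) !orbF => h.
  apply/(class_eqP (conn_sym E)); case/orP: h => // /andP[ax ay].
  by apply: conn_trans ay; rewrite connC.
by apply/subset_leq_card/imsetS/finset.subsetT.
Qed.

Lemma ncc_cat E1 E2 : (ncc E2 <= ncc (E1 ++ E2) + size E1)%N.
Proof.
elim: E1 => [|[a b] E1 IH] /=; first by rewrite addn0.
by rewrite addnS -addSn (leq_trans IH)// leq_add2r ncc_cons.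
Qed.

(* [E] induces a fixed-point free involution of the half-edges in [D]. *)
Definition matched (D : {set H}) E : Prop :=
  {in D, forall x, #|[set z in D | conn E x z]| = 2}.

(** Identifying [a] with [b] makes their former partners partners of each other; if [a] and [b] were
    partners already, their class becomes a circle without live point. *)
Lemma matched_cons (D : {set H}) E a b : a \in D -> b \in D -> a != b ->
  matched D E -> matched (D :\ a :\ b) ((a, b) :: E).
Proof.
move=> aD bD ab M x; rewrite !inE => /and3P[xb xa xD].
have [xab|xab] := boolP (conn E a x || conn E b x); last first.
  rewrite -(M x xD); apply: eq_card => z; rewrite !inE conn_cons (negbTE xab) orbF.
  rewrite negb_or in xab; case/andP: xab => ax bx.
  case: (eqVneq z b) => [->|zb]; first by rewrite connC (negbTE bx) !andbF.
  by case: (eqVneq z a) => [->|za]; rewrite //= connC (negbTE ax) ?andbF.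
have -> : [set z in D :\ a :\ b | conn ((a, b) :: E) x z] =
    ([set z in D | conn E a z] :|: [set z in D | conn E b z]) :\ a :\ b.
  apply/setP => z; rewrite !inE conn_cons xab /= -andb_orr.
  case: (z != b) => //=; case: (z != a) => //=; case: (z \in D) => //=.
  apply/idP/idP => [/orP[xz|//]|->]; last by rewrite orbT.
  by case/orP: xab => h; rewrite (conn_trans h xz) ?orbT.
(* If [a] and [b] are partners, their class of two points would contain [x] as a third one. *)
have [cab|cab] := boolP (conn E a b).
  have Eab : [set z in D | conn E b z] = [set z in D | conn E a z].
    apply/setP => z; rewrite !inE; congr (_ && _).
    apply/idP/idP; apply: conn_trans => //; by rewrite connC.
  have := M a aD; rewrite (cardsD1 a) (cardsD1 b) (cardsD1 x) !inE.
  rewrite aD bD xD xa xb conn_refl cab eq_sym ab /=.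
  case/orP: xab => [-> //|bx]; by rewrite (conn_trans cab bx).
have dis : [set z in D | conn E a z] :&: [set z in D | conn E b z] = finset.set0.
  apply/setP => z; rewrite !inE; apply/negP => /andP[/andP[_ az] /andP[_ bz]].
  by move/negP: cab; apply; apply: conn_trans az _; rewrite connC.
have := cardsU [set z in D | conn E a z] [set z in D | conn E b z].
rewrite dis cards0 subn0 !M// (cardsD1 a) (cardsD1 b) !inE aD bD !conn_refl.
by rewrite eq_sym ab /= orbT => -[].
Qed.

End PairRelation.

Section Glue.
Variables (H V : finType) (h : V -> nat -> H) (deg : V -> nat).

Definition cliques (L : {set V}) : seq (H * H) :=
  [seq (h v 0, h v k) | v <- enum L, k <- iota 0 (deg v)].

(** Leg [sigma k] of [u] faces leg [k] of [v], the convention of [permuted_bdry] when [u] is the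
    added vertex. *)
Definition glue p (u v : V) (sigma : 'S_p) : seq (H * H) :=
  [seq (h u (sigma k), h v k) | k <- enum 'I_p].

Lemma cliquesP (L : {set V}) x y :
  reflect (exists2 v, v \in L & exists2 k, (k < deg v)%N & (x, y) = (h v 0, h v k))
    ((x, y) \in cliques L).
Proof.
apply: (iffP allpairsPdep) => [[v [k [vL kd ->]]]|[v vL [k kd ->]]].
  by exists v; [rewrite mem_enum in vL|exists k => //; rewrite mem_iota in kd].
by exists v, k; rewrite mem_enum mem_iota.
Qed.

(* [cliques L] connects the legs of each vertex of [L]. Keeping the legs of [u]
   together costs [p - 1] pairs, after which those of [v] are together as well. *)
Lemma ncc_glue p (L : {set V}) (u v : V) (sigma : 'S_p) E : (0 < p)%N ->
  deg u = p -> deg v = p ->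
  (ncc ((glue u v sigma ++ E) ++ cliques (L :\ u :\ v)) <=
    ncc (E ++ cliques L) + p.-1)%N.
Proof.
move=> p0 du dv; set E2 := (_ ++ _) ++ _.
pose E1 := [seq (h u 0, h u k) | k <- iota 1 p.-1].
apply: (leq_trans (ncc_cat E1 E2)); rewrite size_map size_iota leq_add2r.
apply/ncc_sub/conn_sub => -[x y]; rewrite mem_cat => /orP[xE|/cliquesP[w wL [k kw]]].
  by apply: conn1; rewrite /E2 !mem_cat xE !orbT.
have cu j : (j < p)%N -> conn (E1 ++ E2) (h u 0) (h u j).
  case: j => [_|j jp]; first exact: conn_refl.
  apply: conn1; rewrite mem_cat; apply/orP; left; apply/mapP; exists j.+1 => //.
  by rewrite mem_iota /= add1n prednK.
have cg (j : 'I_p) : conn (E1 ++ E2) (h u (sigma j)) (h v j).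
  apply: conn1; rewrite !mem_cat; apply/orP; right; apply/orP; left; apply/orP; left.
  by apply/mapP; exists j; rewrite ?mem_enum.
have cv j : (j < p)%N -> conn (E1 ++ E2) (h u 0) (h v j).
  by move=> jp; apply: conn_trans (cg (Ordinal jp)); apply: cu.
case=> -> ->.
have [wu|wu] := eqVneq w u; first by rewrite wu; apply: cu; rewrite -du -wu.
have [wv|wv] := eqVneq w v.
  apply: (conn_trans (y := h u 0)); first by rewrite connC wv; exact: cv.
  by rewrite wv; apply: cv; rewrite -dv -wv.
apply: conn1; rewrite !mem_cat; apply/orP; right; apply/orP; right.
by apply/cliquesP; exists w; rewrite ?inE ?wu ?wv//; exists k.
Qed.

End Glue.

(** * Networks *)

Section CycleIndexing.
Variables (n : nat) (s : {perm 'I_n}).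

Lemma cycle_nth_ex (c : pcycle s) x : x \in val c ->
  exists2 k, (k < #|val c|)%N & cycle_nth c k = x.
Proof.
rewrite cycle_leastE porbit_traject => /trajectP[k kc ->].
by exists k => //; rewrite porbit_traject size_traject in kc.
Qed.

Lemma cycle_nth_in (c : pcycle s) k : cycle_nth c k \in val c.
Proof. by rewrite cycle_leastE /cycle_nth -permX mem_porbit. Qed.

Lemma cycle_of_in (c : pcycle s) x : x \in val c -> cycle_of s x = c.
Proof. by move=> xc; apply: val_inj; rewrite /= (cycle_eq xc). Qed.

Lemma cycle_of_least (c : pcycle s) : cycle_of s (least c) = c.
Proof. exact/cycle_of_in/least_in. Qed.

Lemma mem_cycle_of x : x \in val (cycle_of s x).
Proof. exact: porbit_id. Qed.

Lemma cycle_of_perm x : cycle_of s (s x) = cycle_of s x.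
Proof.
apply: cycle_of_in; rewrite /= -[in X in X \in _](expg1 s).
exact: mem_porbit.
Qed.

Lemma involutive_cycle x y : involutive s -> cycle_of s x = cycle_of s y ->
  (y == x) || (y == s x).
Proof.
move=> sK xy; have : y \in val (cycle_of s x) by rewrite xy mem_cycle_of.
move=> /porbitP[k ->]; elim: k => [|k IH]; first by rewrite expg0 perm1 eqxx.
by rewrite expgSr permM; case/orP: IH => /eqP ->; rewrite ?sK eqxx ?orbT.
Qed.

End CycleIndexing.

Section Respects.
Variables (H : finType) (N : nat).
Implicit Types (E : seq (H * H)) (i : {ffun H -> 'I_N}).

Definition respects E i := all (fun e => i e.1 == i e.2) E.

Lemma respects_conn E i : respects E i -> forall x y, conn E x y -> i x = i y.
Proof.
move=> /allP iE x y xy; apply/eqP; move: x y xy.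
apply: (@connect_min _ _ [rel x y | i x == i y]).
- by move=> x /=.
- by move=> y x z /= /eqP -> /eqP ->.
- by move=> x y /orP[/iE //|/iE]; rewrite /= eq_sym.
Qed.

Lemma conn_respects E i : (forall x y, conn E x y -> i x = i y) -> respects E i.
Proof. by move=> h; apply/allP => -[x y] /conn1 /h /eqP. Qed.

End Respects.

(* A network consists of points [H], whose indices are identified along a list of
   pairs [E], and of vertices [V], the [k]-th leg of [v] being at the point [h v k].
   Gluing and removing vertices only changes the set [L] of vertices in use and the
   list [E]. *)
Section NetworkSum.
Variables (H V : finType) (I : eqType) (ell : I -> nat) (lab : V -> I).
Variables (h : V -> nat -> H) (R : realType) (N : nat).

Definition vertex_factor (A : tensor_family R N ell) (i : {ffun H -> 'I_N})
    (v : V) : R[i] :=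
  A (lab v) [tuple i (h v k) | k < ell (lab v)].

Definition network_sum (A : tensor_family R N ell) (L : {set V})
    (E : seq (H * H)) : R[i] :=
  \sum_(i : {ffun H -> 'I_N} | respects E i) \prod_(v in L) vertex_factor A i v.

End NetworkSum.

Lemma adjacent_sym q (m : cmap q) : connect_sym (@Defs.adjacent q m).
Proof.
apply: sym_connect_sym => x y; rewrite /Defs.adjacent /= orbCA.
by congr [|| _, _ | _]; apply/eqP/eqP => ->; rewrite epermK.
Qed.

Section MapNetworkComponents.
Variables (I' : eqType) (ell' : I' -> nat) (n : imap ell' 0).
Variables (H V : finType) (h : V -> nat -> H) (deg : V -> nat).
Variables (phi : 'I_(nhe n) -> H) (f : vertex n -> V) (E : seq (H * H)).
Hypothesis degE : forall v : vertex n, deg (f v) = #|val v|.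
Hypothesis hE : forall (v : vertex n) k, (k < #|val v|)%N ->
  h (f v) k = phi (cycle_nth v k).
(** [phi] need not be injective: for the added vertex, both ends of a former boundary edge sit at
    the same point. *)
Hypothesis connE : forall x y,
  conn E (phi x) (phi y) = (y == x) || (y == eperm n x).

(* The components of [E] meeting no half-edge of the map are the circles created
   by gluing. *)
Definition nfree : nat :=
  #|[set C in components (pair_rel E) | [forall x, phi x \notin C]]|.

Let L : {set V} := [set f v | v in [set: vertex n]].
Let adj := @Defs.adjacent 0 n.
Let E1 := E ++ cliques h deg L.

Let subE : subrel (conn E) (conn E1).
Proof. by apply: conn_subset => e eE; rewrite mem_cat eE. Qed.

Let adj_sym : connect_sym adj. Proof. exact: adjacent_sym. Qed.

Let adj_cycle (v : vertex n) k : connect adj (cycle_nth v 0) (cycle_nth v k).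
Proof.
elim: k => [|k IH]; first exact: connect0.
by apply: connect_trans IH _; apply: connect1; rewrite /adj /Defs.adjacent /= eqxx.
Qed.

Let conn_clique (v : vertex n) x : x \in val v -> conn E1 (h (f v) 0) (phi x).
Proof.
move=> /cycle_nth_ex[k kv <-]; rewrite -hE//; apply: conn1.
rewrite mem_cat; apply/orP; right; apply/cliquesP; exists (f v).
  by rewrite imset_f.
by exists k; rewrite ?degE.
Qed.

(** An explicit upper bound for [conn E1]: a path either stays within [E], or it enters and leaves
    the map at two half-edges of one component. Paths compose because [connE] turns an
    [E]-connection of half-edges back into an edge of the map. *)
Let Q : rel H := fun x x' => conn E x x' || [exists y, exists y',
  [&& conn E x (phi y), conn E (phi y') x' & connect adj y y']].

Let connQ : subrel (conn E1) Q.
Proof.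
apply: connect_min.
- by move=> x; rewrite /Q conn_refl.
- move=> y x z /orP[xy|/existsP[a /existsP[a' /and3P[xa a'y aa']]]].
    move=> /orP[yz|/existsP[b /existsP[b' /and3P[yb b'z bb']]]]; apply/orP.
      by left; exact: conn_trans xy yz.
    right; apply/existsP; exists b; apply/existsP; exists b'.
    by rewrite (conn_trans xy yb) b'z.
  move=> /orP[yz|/existsP[b /existsP[b' /and3P[yb b'z bb']]]]; apply/orP; right.
    apply/existsP; exists a; apply/existsP; exists a'.
    by rewrite xa aa' (conn_trans a'y yz).
  apply/existsP; exists a; apply/existsP; exists b'; rewrite xa b'z /=.
  apply: connect_trans aa' (connect_trans _ bb').
  have := conn_trans a'y yb; rewrite connE => /orP[/eqP ->|/eqP ->].
    exact: connect0.
  by apply: connect1; rewrite /adj /Defs.adjacent /= eqxx !orbT.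
- have hQ v k : (k < deg (f v))%N ->
      Q (h (f v) 0) (h (f v) k) && Q (h (f v) k) (h (f v) 0).
    rewrite degE => kv; have v0 : (0 < #|val v|)%N by exact: leq_ltn_trans kv.
    rewrite !hE//; apply/andP; split; apply/orP; right.
      apply/existsP; exists (cycle_nth v 0); apply/existsP; exists (cycle_nth v k).
      by rewrite !conn_refl adj_cycle.
    apply/existsP; exists (cycle_nth v k); apply/existsP; exists (cycle_nth v 0).
    by rewrite !conn_refl adj_sym adj_cycle.
  move=> x y /orP[|]; rewrite mem_cat => /orP[/conn1 xy|].
  + by rewrite /Q xy.
  + by move=> /cliquesP[_ /imsetP[v _ ->] [k /hQ/andP[+ _] [-> ->]]].
  + by rewrite /Q connC xy.
  + by move=> /cliquesP[_ /imsetP[v _ ->] [k /hQ/andP[_ +] [-> ->]]].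
Qed.

Let conn_phi x y : conn E1 (phi x) (phi y) = connect adj x y.
Proof.
have cadj a b : conn E (phi a) (phi b) -> connect adj a b.
  rewrite connE => /orP[/eqP ->|/eqP ->]; first exact: connect0.
  by apply: connect1; rewrite /adj /Defs.adjacent /= eqxx !orbT.
apply/idP/idP.
  move=> /connQ/orP[/cadj//|/existsP[a /existsP[b /and3P[/cadj xa /cadj yb ab]]]].
  exact: connect_trans xa (connect_trans ab yb).
have vp z : conn E1 (phi z) (phi (vperm n z)).
  apply: (conn_trans (y := h (f (cycle_of (vperm n) z)) 0)).
    by rewrite connC; apply: conn_clique; exact: mem_cycle_of.
  by apply: conn_clique; rewrite -cycle_of_perm; exact: mem_cycle_of.
apply: (@connect_min _ _ (fun x y => conn E1 (phi x) (phi y))).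
- by move=> z; exact: conn_refl.
- by move=> b a c; exact: conn_trans.
- move=> a b /or3P[/eqP ->|/eqP ->|/eqP ->]; first exact: vp.
    by rewrite connC; exact: vp.
  by apply: subE; rewrite connE eqxx orbT.
Qed.

(** [M] is the set of points that [E] connects to a half-edge. It is a union of classes of [E1]:
    those inside are the components of the map, those outside are unchanged classes of [E], the free
    ones. *)
Lemma ncc_map_network : ncc E1 = (ncomp n + nfree)%N.
Proof.
pose M := [set x | [exists y, conn E x (phi y)]].
pose F x := [set z | conn E1 x z].
have Mcl x y : conn E1 x y -> conn E x y \/ x \in M /\ y \in M.
  move=> /connQ/orP[|/existsP[a /existsP[b /and3P[xa yb ab]]]]; [by left|right].
  by split; rewrite inE; apply/existsP; [exists a|exists b; rewrite connC].
have Mcl' x y : conn E1 x y -> x \in M -> y \in M.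
  move=> /Mcl[xy|[]//]; rewrite !inE => /existsP[a xa]; apply/existsP; exists a.
  by apply: conn_trans xa; rewrite connC.
have -> : ncc E1 = #|F @: M| + #|F @: ~: M|.
  rewrite /ncc /components -/F -(finset.setUCr M) imsetU cardsU.
  rewrite [X in (_ - X)%N](_ : _ = 0%N) ?subn0//; apply/eqP; rewrite cards_eq0.
  apply/eqP/setP => C; rewrite !inE; apply/negP => /andP[].
  move=> /imsetP[x xM ->] /imsetP[y yM]; move/(class_eqP (conn_sym E1)) => xy.
  by move: yM; rewrite inE (Mcl' _ _ xy xM).
congr (_ + _)%N.
  have -> : F @: M = (F \o phi) @: [set: 'I_(nhe n)].
    apply/setP => C; apply/imsetP/imsetP => [[x]|[x _ ->]].
      rewrite inE => /existsP[y xy] ->; exists y; first by rewrite inE.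
      by apply/(class_eqP (conn_sym E1)); exact: subE.
    by exists (phi x) => //; rewrite inE; apply/existsP; exists x; exact: conn_refl.
  apply: eq_card_kernel => x y _ _ /=.
  by rewrite (class_eqP adj_sym) (class_eqP (conn_sym E1)) -/(conn E1 _ _) conn_phi.
transitivity #|[set [set z | conn E x z] | x in ~: M]|.
  apply: eq_card_kernel => x y; rewrite !inE => xM yM.
  rewrite (class_eqP (conn_sym E)) (class_eqP (conn_sym E1)); split; first exact: subE.
  by move=> /Mcl[//|[]]; rewrite !inE => xM'; rewrite xM' in xM.
apply: eq_card => C; rewrite inE; apply/imsetP/andP.
  move=> [x xM ->]; split; first by rewrite imset_f.
  apply/forallP => y; rewrite inE; move: xM; rewrite !inE negb_exists.
  by move=> /forallP; exact.
move=> [/imsetP[x _ ->] /forallP fr]; exists x => //; rewrite !inE negb_exists.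
by apply/forallP => y; have := fr y; rewrite inE.
Qed.

End MapNetworkComponents.

Section MapNetworkSum.
Variables (I I' : eqType) (ell : I -> nat) (ell' : I' -> nat) (n : imap ell' 0).
Variables (H V : finType) (lab : V -> I) (h : V -> nat -> H).
Variables (R : realType) (N : nat).
Variables (phi : 'I_(nhe n) -> H) (f : vertex n -> V) (E : seq (H * H)).
Hypothesis f_inj : injective f.
Hypothesis connE : forall x y,
  conn E (phi x) (phi y) = (y == x) || (y == eperm n x).
Hypothesis N0 : (0 < N)%N.

Let n0 : 'I_N := Ordinal N0.

Let conn_edge x y : conn E (phi x) (phi y) ->
  cycle_of (eperm n) x = cycle_of (eperm n) y.
Proof. by rewrite connE => /orP[/eqP ->//|/eqP ->]; rewrite cycle_of_perm. Qed.

Let edge_conn x y : cycle_of (eperm n) x = cycle_of (eperm n) y ->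
  conn E (phi x) (phi y).
Proof. by move=> xy; rewrite connE; apply: involutive_cycle xy; exact: epermK. Qed.

Let cls x := [set z | conn E x z].

Let free := [set C in components (pair_rel E) | [forall x, phi x \notin C]].

Let cls_free x : (cls x \in free) = ~~ [exists y, conn E x (phi y)].
Proof.
rewrite inE imset_f ?inE//= negb_exists; apply/forallP/forallP => h1 y.
  by have := h1 y; rewrite inE.
by rewrite inE.
Qed.

Let edge_index (i : {ffun H -> 'I_N}) : {ffun edge n -> 'I_N} :=
  [ffun c => i (phi (least c))].

Let edge_indexE i x : respects E i -> edge_index i (cycle_of (eperm n) x) = i (phi x).
Proof.
move=> iE; rewrite ffunE; apply: (respects_conn iE); apply: edge_conn.
exact: cycle_of_least.
Qed.

(** Inverse to restriction: an indexing that respects [E] amounts to an index for each edge of the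
    map and one for each free class. A point connected to no half-edge has a free class, so [n0] is
    never reached. *)
Let extend (j : {ffun edge n -> 'I_N}) (g : {ffun {C | C \in free} -> 'I_N}) :
    {ffun H -> 'I_N} :=
  [ffun x => if [pick y | conn E x (phi y)] is Some y then j (cycle_of (eperm n) y)
             else if insub (cls x) is Some C then g C else n0].

Let extendP j g x y : conn E x (phi y) -> extend j g x = j (cycle_of (eperm n) y).
Proof.
move=> xy; rewrite ffunE; case: pickP => [z xz|/(_ y)]; last by rewrite xy.
by congr (j _); apply: conn_edge; apply: conn_trans xy; rewrite connC.
Qed.

Let extend_free j g x (xf : cls x \in free) : extend j g x = g (exist _ (cls x) xf).
Proof.
rewrite ffunE; case: pickP => [z xz|_].
  by exfalso; have := xf; rewrite cls_free => /negP[]; apply/existsP; exists z.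
by rewrite insubT.
Qed.

Let extend_respects j g : respects E (extend j g).
Proof.
apply: conn_respects => x y xy.
have [/existsP[z xz]|] := boolP [exists z, conn E x (phi z)].
  by rewrite (extendP _ _ xz) (@extendP _ _ y z)//; apply: conn_trans xz; rewrite connC.
rewrite -cls_free => xf.
have xyc : cls x = cls y by apply/(class_eqP (conn_sym E)).
have yf : cls y \in free by rewrite -xyc.
rewrite !extend_free; congr (g _); exact: val_inj.
Qed.

Let edge_index_extend j g : edge_index (extend j g) = j.
Proof.
apply/ffunP => c; rewrite -[in LHS](cycle_of_least c) edge_indexE ?extend_respects//.
by rewrite (@extendP _ _ _ (least c)) ?conn_refl// cycle_of_least.
Qed.

Let extend_inj j : injective (extend j).
Proof.
move=> g g' gg'; apply/ffunP => -[C Cf].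
have /imsetP[x _ Cx] : C \in components (pair_rel E).
  by move: Cf; rewrite inE => /andP[].
subst C; have := congr1 (fun i : {ffun H -> 'I_N} => i x) gg'.
by rewrite !(extend_free _ _ Cf).
Qed.

Let card_fibre (j : {ffun edge n -> 'I_N}) :
  #|[pred i | respects E i && (edge_index i == j)]| = (N ^ #|free|)%N.
Proof.
have -> : (N ^ #|free|)%N = #|{ffun {C | C \in free} -> 'I_N}|.
  by rewrite card_ffun card_ord card_sig.
rewrite -(card_codom (@extend_inj j)); apply: eq_card => i.
rewrite inE /=; apply/andP/codomP => [[iE /eqP ij]|[g ->]]; last first.
  by rewrite extend_respects edge_index_extend eqxx.
exists [ffun C : {C | C \in free} => if [pick x in val C] is Some x then i x else n0].
apply/ffunP => x; have [/existsP[y xy]|] := boolP [exists y, conn E x (phi y)].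
  by rewrite (extendP _ _ xy) -ij edge_indexE//; exact: respects_conn xy.
rewrite -cls_free => xf; rewrite (extend_free _ _ xf) ffunE /=.
case: pickP => [y|/(_ x)]; last by rewrite inE conn_refl.
by rewrite inE => xy; apply: respects_conn xy.
Qed.

Let L : {set V} := [set f v | v in [set: vertex n]].

Variables (A : tensor_family R N ell) (A' : tensor_family R N ell').
Hypothesis degE : forall v : vertex n, ell (lab (f v)) = #|val v|.
Hypothesis hE : forall (v : vertex n) k, (k < #|val v|)%N ->
  h (f v) k = phi (cycle_nth v k).
Hypothesis AE : forall (i : {ffun H -> 'I_N}) (v : vertex n),
  @A' (label v) [tuple i (phi (cycle_nth v k)) | k < ell' (label v)] =
  vertex_factor lab h A i (f v).

(** Each indexing of the edges comes from N^[nfree] indexings of the points. This cancels the part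
    of the normalization that counts the free classes and leaves the one by [ncomp n]. *)
Lemma trace_scalar_network : trace_scalar A' n =
  N%:R ^- (ncc (E ++ cliques h (fun v => ell (lab v)) L)) *
  network_sum lab h A L E.
Proof.
rewrite (ncc_map_network degE hE connE) /trace_scalar /trace_action /=.
rewrite exprD invfM -mulrA; congr (_ * _).
rewrite /network_sum (partition_big edge_index predT)//= mulr_sumr.
apply: eq_big => [i|i _]; first by apply/forallP => -[].
set G := (X in X = _).
have -> : \sum_(j | respects E j && (edge_index j == i))
      \prod_(v in L) vertex_factor lab h A j v =
    \sum_(j in [pred j | respects E j && (edge_index j == i)]) G.
  apply: eq_bigr => j /andP[jE /eqP ji].
  rewrite big_imset /=; last by move=> x y _ _; exact: f_inj.
  apply: eq_big => [v|v _]; first by rewrite inE.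
  rewrite -AE; congr (@A' _ _); apply: eq_from_tnth => k.
  by rewrite !tnth_mktuple -ji edge_indexE.
rewrite sumr_const card_fibre -[X in _ * X]mulr_natl natrX mulrA -/(nfree phi E).
by rewrite mulVf ?mul1r// expf_neq0// pnatr_eq0 -lt0n.
Qed.

End MapNetworkSum.

(** * Gaussian integration by parts *)

Section SymmetricTuples.
Variables (N p : nat).
Implicit Types (t : p.-tuple 'I_N) (sigma : 'S_p).

Definition permute_tuple t sigma : p.-tuple 'I_N :=
  [tuple tnth t (sigma k) | k < p].

(** The choice depends on the class only, since equivalent tuples give the same predicate to [pick].
    The entries of X at these representatives are independent. *)
Definition class_rep t : p.-tuple 'I_N :=
  odflt t [pick t' : p.-tuple 'I_N | perm_eq t' t].

Lemma perm_class_rep t : perm_eq (class_rep t) t.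
Proof. by rewrite /class_rep; case: pickP => //= t'. Qed.

Lemma class_rep_eq t t' : (class_rep t == class_rep t') = perm_eq t t'.
Proof.
apply/eqP/idP => [tt'|tt'].
  by rewrite perm_sym (perm_trans _ (perm_class_rep t))// tt' perm_sym perm_class_rep.
rewrite /class_rep; have -> : [pick t0 : p.-tuple 'I_N | perm_eq t0 t'] =
    [pick t0 : p.-tuple 'I_N | perm_eq t0 t].
  apply: eq_pick => t0 /=; apply/idP/idP => h; apply: perm_trans h _ => //.
  by rewrite perm_sym.
by case: pickP => //= /(_ t); rewrite perm_refl.
Qed.

Let stab t t' : {set 'S_p} := [set sigma | permute_tuple t sigma == t'].

Let perm_permute t sigma : perm_eq (permute_tuple t sigma) t.
Proof. by apply/tuple_permP; exists sigma. Qed.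

Let leq_stab t t1 t2 : perm_eq t1 t -> perm_eq t2 t ->
  (#|stab t t1| <= #|stab t t2|)%N.
Proof.
move=> /tuple_permP[r1 e1] /tuple_permP[r2 e2].
have E1 : t1 = permute_tuple t r1 by exact: val_inj.
have E2 : t2 = permute_tuple t r2 by exact: val_inj.
rewrite -(card_imset (mem (stab t t1)) (mulgI (r2 * r1^-1)%g)).
apply: subset_leq_card; apply/fintype.subsetP => _ /imsetP[sigma + ->].
rewrite !inE => /eqP st; apply/eqP; rewrite E2; apply: eq_from_tnth => k.
rewrite !tnth_mktuple !permM.
have := congr1 (fun t0 => tnth t0 (r1^-1 (r2 k))%g) st.
by rewrite E1 !tnth_mktuple permKV.
Qed.

(** Orbit counting: left translations show that every rearrangement of [t] is reached by equally
    many permutations. *)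
Lemma card_permute_tuple t t' : perm_eq t' t ->
  (#|[set sigma | permute_tuple t sigma == t']| * nperms t = p`!)%N.
Proof.
move=> tt'; rewrite -card_Sn -cardsT.
have -> : #|[set: 'S_p]| = (\sum_(t1 : p.-tuple 'I_N | perm_eq t1 t) #|stab t t1|)%N.
  rewrite -sum1_card (partition_big (permute_tuple t)
    (fun t1 : p.-tuple 'I_N => perm_eq t1 t)) /=; last first.
    by move=> sigma _; exact: perm_permute.
  apply: eq_bigr => t1 _; rewrite -sum1_card; apply: eq_bigl => sigma.
  by rewrite !inE.
rewrite (eq_bigr (fun=> #|stab t t'|)); last first.
  by move=> t1 tt1; apply/eqP; rewrite eqn_leq !leq_stab.
rewrite (eq_bigl (mem [set j : p.-tuple 'I_N | perm_eq j t])); last first.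
  by move=> j; rewrite !inE.
by rewrite sum_nat_const mulnC.
Qed.

Lemma nperms_gt0 t : (0 < nperms t)%N.
Proof. by apply/fintype.card_gt0P; exists t; rewrite inE. Qed.

Lemma nperms_rep t : nperms (class_rep t) = nperms t.
Proof.
apply: eq_card => j; rewrite !inE; apply/idP/idP => h; apply: perm_trans h _.
  exact: perm_class_rep.
by rewrite perm_sym perm_class_rep.
Qed.

(** The left side is the covariance of two entries of X. Within a class, p / nperms = #{sigma} /
    (p-1)! because #{sigma} * nperms = p!. *)
Lemma tuple_covariance (R : realType) t t' : (0 < p)%N ->
  (if class_rep t' == class_rep t then p%:R / (nperms (class_rep t))%:R else 0) =
  (p.-1)`!%:R^-1 * \sum_(sigma : 'S_p) (permute_tuple t sigma == t')%:R :> R.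
Proof.
move=> p0.
have -> : \sum_(sigma : 'S_p) (permute_tuple t sigma == t')%:R =
    #|[set sigma | permute_tuple t sigma == t']|%:R :> R.
  rewrite -sum1_card natr_sum [RHS]big_mkcond /=.
  by apply: eq_bigr => sigma _; rewrite inE; case: eqP.
rewrite class_rep_eq; case: ifP => [tt'|tt'].
  rewrite nperms_rep; apply/eqP; rewrite [X in _ == X]mulrC.
  rewrite eqr_div ?pnatr_eq0 -?lt0n ?fact_gt0 ?nperms_gt0//.
  have pf : (p * (p.-1)`! = p`!)%N by case: (p) p0.
  by rewrite -!natrM (card_permute_tuple tt') pf.
rewrite (_ : [set sigma | _] = finset.set0) ?cards0 ?mulr0//.
apply/setP => sigma; rewrite !inE; apply/negP => /eqP e.
by rewrite -e perm_permute in tt'.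
Qed.

End SymmetricTuples.

Section ComplexExpectation.
Context d (T : measurableType d) (R : realType) (P : probability T R).

Lemma Rintegral_lincomb (K : finType) (Q : pred K) (b : K -> R) (Y : K -> T -> R) :
  (forall k, P.-integrable setT (EFin \o Y k)) ->
  \int[P]_w (\sum_(k | Q k) b k * Y k w) =
  \sum_(k | Q k) b k * \int[P]_w Y k w.
Proof.
move=> iY; rewrite /Rintegral.
under eq_integral do rewrite -sumEFin.
rewrite integral_sum//; last first.
  by move=> k; exact: (integrableZl measurableT (b k) (iY k)).
rewrite (eq_bigr (fun k => (b k * \int[P]_w Y k w)%:E)); last first.
  move=> k _; under eq_integral do rewrite EFinM.
  rewrite (integralZl measurableT (iY k)) -[X in (_ * X)%E]fineK//.
  exact: integrable_fin_num (iY k).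
by rewrite sumEFin.
Qed.

Lemma complex_expectation_lincomb (K : finType) (Q : pred K) (a : K -> R[i])
    (Y : K -> T -> R) :
  (forall k, P.-integrable setT (EFin \o Y k)) ->
  complex_expectation P (fun w => \sum_(k | Q k) a k * (Y k w)%:C) =
  \sum_(k | Q k) a k * (\int[P]_w Y k w)%:C.
Proof.
move=> iY; rewrite /complex_expectation unlock.
have Re_sum (F : K -> R[i]) :
    complex.Re (\sum_(k | Q k) F k) = \sum_(k | Q k) complex.Re (F k).
  by apply: (big_morph (@complex.Re R)) => // -[? ?] [? ?].
have Im_sum (F : K -> R[i]) :
    complex.Im (\sum_(k | Q k) F k) = \sum_(k | Q k) complex.Im (F k).
  by apply: (big_morph (@complex.Im R)) => // -[? ?] [? ?].
have ReM (z : R[i]) (r : R) : complex.Re (z * r%:C) = complex.Re z * r.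
  by case: z => x y; rewrite /= mulr0 subr0.
have ImM (z : R[i]) (r : R) : complex.Im (z * r%:C) = complex.Im z * r.
  by case: z => x y; rewrite /= mulr0 add0r.
apply/eqP; rewrite eq_complex /= Re_sum Im_sum.
under [X in _ == X]eq_bigr do rewrite ReM.
under [X in _ && (_ == X)]eq_bigr do rewrite ImM.
rewrite -!Rintegral_lincomb//; apply/andP; split; apply/eqP; congr fine;
  apply: eq_integral => w _; rewrite ?Re_sum ?Im_sum; congr EFin; apply: eq_bigr => k _.
  exact: ReM.
exact: ImM.
Qed.

End ComplexExpectation.

Section NetworkExpectation.
Variables (R : realType) (p : nat) (N : nat) (p0 : (0 < p)%N).
Context d (T : measurableType d) (P : probability T R).
Variable X : p.-tuple 'I_N -> {RV P >-> R}.
Hypothesis hX : gaussian_symmetric_tensor X.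
Variables (I0 : eqType) (ell0 : I0 -> nat) (A0 : tensor_family R N ell0).
Variables (H V : finType) (lab : V -> option I0) (h : V -> nat -> H).
Implicit Types (L S : {set V}) (E : seq (H * H)) (i : {ffun H -> 'I_N}).

Let c : R := (N%:R `^ ((p%:R - 1) / 2))^-1.

Let family (w : T) : tensor_family R N (ext_ell ell0 p) :=
  ext_family A0 (fun t => X t w / N%:R `^ ((p%:R - 1) / 2)).

Definition network_expectation L E : R[i] :=
  complex_expectation P (fun w => network_sum lab h (family w) L E).

Definition vertex_indices i v : p.-tuple 'I_N := [tuple i (h v k) | k < p].

Definition fixed_factor i v : R[i] :=
  if lab v is Some l then @A0 l [tuple i (h v k) | k < ell0 l] else 1.

Definition random_vertices L : {set V} := [set v in L | lab v == None].

Let vertex_factorE w i v : vertex_factor lab h (family w) i v =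
  fixed_factor i v *
  (if lab v == None then X (vertex_indices i v) w * c else 1)%:C.
Proof.
rewrite /vertex_factor /fixed_factor.
by case: (lab v) => [l|] /=; rewrite ?mulr1 ?mul1r.
Qed.

Let J : {set p.-tuple 'I_N} := [set class_rep t | t in [set: p.-tuple 'I_N]].

Let sd (t : p.-tuple 'I_N) : R := Num.sqrt (p%:R / (nperms t)%:R).

Let indepJ : mutually_independent J X.
Proof.
have [_ + _] := hX; apply=> _ _ /imsetP[t _ ->] /imsetP[t' _ ->] tt'.
apply/eqP; rewrite class_rep_eq.
apply: perm_trans (perm_class_rep t'); rewrite perm_sym.
apply: perm_trans (perm_class_rep t).
by rewrite perm_sym.
Qed.

Let sd2 t : sd t ^+ 2 = p%:R / (nperms t)%:R.
Proof. by rewrite /sd sqr_sqrtr// divr_ge0. Qed.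

Let sd_neq0 t : sd t != 0.
Proof. by rewrite gt_eqF// /sd sqrtr_gt0 divr_gt0// ltr0n// nperms_gt0. Qed.

Let distX t B : measurable B -> distribution P (X t) B = normal_prob 0 (sd t) B.
Proof. by have [_ _] := hX; exact. Qed.

Let monomial i S w : R := \prod_(v in S) X (vertex_indices i v) w.

Let repr i v := class_rep (vertex_indices i v).

Let reprJ i v : repr i v \in J.
Proof. by rewrite /repr /J imset_f. Qed.

Let monomialE i S : monomial i S = (fun w => \prod_(v in S) X (repr i v) w).
Proof.
apply/funext => w; apply: eq_bigr => v _; have [+ _ _] := hX; apply.
by rewrite perm_sym perm_class_rep.
Qed.

Let integrable_monomial_indices i S : P.-integrable setT (EFin \o monomial i S).
Proof.
rewrite monomialE.
exact: (integrable_monomial indepJ sd_neq0 distX (reprJ i) S).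
Qed.

Let moment i S : R := \int[P]_w monomial i S w.

Let glueE i u v (sigma : 'S_p) :
  respects (glue h u v sigma) i =
  (permute_tuple (vertex_indices i u) sigma == vertex_indices i v).
Proof.
rewrite /respects all_map; apply/allP/eqP => [H1|H1 k _].
  apply: eq_from_tnth => k; rewrite !tnth_mktuple; apply/eqP.
  by have := H1 k; rewrite mem_enum; exact.
have /eqP := congr1 (fun t => tnth t k) H1.
by rewrite !tnth_mktuple.
Qed.

Let moment_rec i S u : u \in S -> moment i S =
  (p.-1)`!%:R^-1 * \sum_(v in S :\ u) \sum_(sigma : 'S_p)
    (respects (glue h u v sigma) i)%:R * moment i (S :\ u :\ v).
Proof.
move=> uS; rewrite /moment monomialE (wick_rec indepJ sd_neq0 distX (reprJ i) uS).
rewrite mulr_sumr; apply: eq_bigr => v _.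
rewrite -/(repr i u) sd2 tuple_covariance// -mulrA -mulr_suml; congr (_ * (_ * _)).
  by apply: eq_bigr => sigma _; rewrite glueE.
by rewrite monomialE.
Qed.

Let fixed_prod i L := \prod_(v in L) fixed_factor i v.

(** [complex_expectation] is linear only where integrals are finite. The scalar [z] is therefore
    kept inside until the sum has been expanded into integrable monomials. *)
Let network_expectation_scaled z L E :
  complex_expectation P (fun w => z * network_sum lab h (family w) L E) =
  z * \sum_(i | respects E i) fixed_prod i L *
    (c ^+ #|random_vertices L| * moment i (random_vertices L))%:C.
Proof.
transitivity (complex_expectation P (fun w => \sum_(i | respects E i)
   (z * (fixed_prod i L * (c ^+ #|random_vertices L|)%:C)) *
   (monomial i (random_vertices L) w)%:C)).
  congr complex_expectation; apply/funext => w; rewrite mulr_sumr.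
  apply: eq_bigr => i _.
  under eq_bigr do rewrite vertex_factorE.
  rewrite big_split /= -!mulrA; congr (_ * (_ * _)); rewrite -rmorphM -rmorph_prod.
  congr (_%:C); rewrite -prodr_const -big_split /= [RHS]big_mkcond [LHS]big_mkcond /=.
  apply: eq_bigr => v _; rewrite inE; case: (v \in L) => //=.
  by case: ifP => // _; rewrite mulrC.
rewrite complex_expectation_lincomb// mulr_sumr.
by apply: eq_bigr => i _; rewrite rmorphM !mulrA.
Qed.

Let network_expectationE L E : network_expectation L E =
  \sum_(i | respects E i) fixed_prod i L *
    (c ^+ #|random_vertices L| * moment i (random_vertices L))%:C.
Proof.
rewrite -[RHS]mul1r -network_expectation_scaled; congr complex_expectation.
by apply/funext => w; rewrite mul1r.
Qed.

Lemma complex_expectationZ_network z L E :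
  complex_expectation P (fun w => z * network_sum lab h (ext_family A0
    (fun t => X t w / N%:R `^ ((p%:R - 1) / 2))) L E) = z * network_expectation L E.
Proof. by rewrite network_expectation_scaled network_expectationE. Qed.

Let fixed_prodD1 i L u : u \in L -> lab u == None ->
  fixed_prod i L = fixed_prod i (L :\ u).
Proof.
move=> uL /eqP ul; rewrite /fixed_prod (bigD1 u)//= {1}/fixed_factor ul mul1r.
by apply: eq_bigl => v; rewrite !inE andbC.
Qed.

(** For each fixed indexing, Wick's recursion weights the pairing of [u] with [v] by the number of
    [sigma] whose gluing the indexing respects. Exchanging the sums turns this weight into a
    condition, which joins the list [E]. *)
Lemma network_expectation_rec L E u : (0 < N)%N -> u \in L -> lab u = None ->
  network_expectation L E =
  ((p.-1)`!%:R)^-1 * (N%:R ^- p.-1 *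
    \sum_(v in random_vertices L :\ u) \sum_(sigma : 'S_p)
      network_expectation (L :\ u :\ v) (glue h u v sigma ++ E)).
Proof.
move=> N0 uL ul; have ur : u \in random_vertices L by rewrite inE uL ul.
(* The two removed vertices release two normalizations N^(-(p-1)/2). *)
have c2 : c ^+ 2 = N%:R ^- p.-1.
  rewrite /c exprVn; congr (_^-1).
  rewrite expr2 -powRD ?pnatr_eq0; last by rewrite gtn_eqF// implybT.
  rewrite -splitr -powR_mulrn ?ler0n//; congr (_ `^ _).
  by rewrite -[in LHS](prednK p0) -natr1 addrK.
rewrite network_expectationE.
transitivity (\sum_(i | respects E i)
  \sum_(v in random_vertices L :\ u) \sum_(sigma : 'S_p)
   (p.-1)`!%:R^-1 * (N%:R ^- p.-1 * ((respects (glue h u v sigma) i)%:R *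
    (fixed_prod i (L :\ u :\ v) *
    (c ^+ #|random_vertices (L :\ u :\ v)| *
     moment i (random_vertices (L :\ u :\ v)))%:C)))).
  apply: eq_bigr => i _; rewrite (moment_rec i ur).
  rewrite mulr_sumr mulr_sumr rmorph_sum mulr_sumr; apply: eq_bigr => v vr.
  rewrite mulr_sumr mulr_sumr rmorph_sum mulr_sumr; apply: eq_bigr => sigma _.
  move: vr; rewrite 3!inE => /and3P[vu vL vl].
  have rD : random_vertices (L :\ u :\ v) = random_vertices L :\ u :\ v.
    by apply/setP => z; rewrite !inE; case: (z != u); case: (z != v).
  rewrite rD (fixed_prodD1 i uL) ?ul// (@fixed_prodD1 _ _ v) ?inE ?vu//.
  have -> : #|random_vertices L| = #|random_vertices L :\ u :\ v|.+2.
    by rewrite (cardsD1 u) ur (cardsD1 v) !inE vu vL vl.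
  rewrite -[_.+2]addn2 exprD c2 !rmorphM /=.
  have natC k : (k%:R : R)%:C = k%:R :> R[i] by exact: rmorph_nat.
  have -> : (N%:R ^- p.-1 : R)%:C = N%:R ^- p.-1 :> R[i].
    by rewrite fmorphV rmorphXn /= natC.
  have -> : ((p.-1)`!%:R^-1 : R)%:C = (p.-1)`!%:R^-1 :> R[i].
    by rewrite fmorphV /= natC.
  by rewrite natC; ring.
rewrite exchange_big /= mulr_sumr mulr_sumr; apply: eq_bigr => v vr.
rewrite exchange_big /= mulr_sumr mulr_sumr; apply: eq_bigr => sigma _.
rewrite network_expectationE -mulr_sumr -mulr_sumr; congr (_ * (_ * _)).
rewrite [RHS]big_mkcond [LHS]big_mkcond /=; apply: eq_bigr => i _.
rewrite /respects all_cat; case: (all _ (glue _ _ _ _)); case: (all _ E) => //=.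
  by rewrite mul1r.
by rewrite mul0r.
Qed.

End NetworkExpectation.

(** * Boundedness of the expected traces *)

(** The legs of a vertex are numbered from its least half-edge; an increasing renumbering preserves
    least elements and thereby the order of the legs. *)
Lemma enum_val_mono n (S : {set 'I_n}) (x y : 'I_#|S|) :
  (x <= y)%N -> (enum_val x <= enum_val y)%N.
Proof.
rewrite leq_eqVlt => /orP[/eqP/val_inj -> //|xy]; apply: ltnW.
have d0 : 'I_n by exact: enum_val x.
have srt : sorted ltn (map val (enum S)).
  rewrite /enum_mem -enumT.
  apply: (subseq_sorted ltn_trans _ (iota_ltn_sorted 0 n)).
  rewrite -val_enum_ord; apply: map_subseq; exact: filter_subseq.
rewrite !(enum_val_nth d0).
have sz : size (map val (enum S)) = #|S| by rewrite size_map -cardE.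
have := sorted_ltn_nth ltn_trans 0%N srt x y; rewrite !inE sz.
move=> /(_ (ltn_ord x) (ltn_ord y) xy).
by rewrite !(nth_map d0) -?cardE.
Qed.

Lemma least_min n (r : {perm 'I_n}) (c : pcycle r) x :
  x \in val c -> (least c <= x)%N.
Proof.
by rewrite /least; case: arg_minnP => [|y _ ymin]; [exact: xchooseP|exact: ymin].
Qed.

Section SubCycles.
Variables (a b : nat) (s : {perm 'I_a}) (t : {perm 'I_b}) (phi : 'I_a -> 'I_b).
Hypothesis phi_inj : injective phi.
Hypothesis phi_mono : forall x y : 'I_a, (x <= y)%N -> (phi x <= phi y)%N.
Hypothesis phi_perm : forall x, phi (s x) = t (phi x).

Definition image_cycle (c : pcycle s) : pcycle t := cycle_of t (phi (least c)).

Let phiX k x : phi ((s ^+ k)%g x) = (t ^+ k)%g (phi x).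
Proof. by elim: k => [|k IH]; rewrite ?expg0 ?perm1// !expgSr !permM phi_perm IH. Qed.

Lemma mem_image_cycle (c : pcycle s) x :
  (phi x \in val (image_cycle c)) = (x \in val c).
Proof.
rewrite (cycle_leastE c) /=; apply/porbitP/porbitP => -[k].
  by rewrite -phiX => /phi_inj ->; exists k.
by move=> ->; exists k; rewrite phiX.
Qed.

Lemma image_cycle_inj : injective image_cycle.
Proof.
move=> c c' cc'; have := mem_image_cycle c (least c').
rewrite cc' mem_image_cycle least_in => /esym h.
by rewrite -(cycle_of_in h) cycle_of_least.
Qed.

Lemma card_image_cycle (c : pcycle s) : #|val (image_cycle c)| = #|val c|.
Proof. by rewrite (cycle_leastE c); exact: card_porbit_morph. Qed.

Lemma least_image_cycle (c : pcycle s) : least (image_cycle c) = phi (least c).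
Proof.
apply: val_inj; apply/eqP; rewrite eqn_leq; apply/andP; split.
  by apply: least_min; rewrite mem_image_cycle least_in.
have := least_in (image_cycle c); rewrite {1}/image_cycle /= => /porbitP[k].
rewrite -phiX => ->; apply: phi_mono; apply: least_min.
by rewrite cycle_leastE mem_porbit.
Qed.

Lemma cycle_nth_image (c : pcycle s) k :
  cycle_nth (image_cycle c) k = phi (cycle_nth c k).
Proof. by rewrite /cycle_nth least_image_cycle -!permX phiX. Qed.

Lemma image_cycle_onto (L : {set pcycle t}) :
  (forall x, (x \in [set phi y | y in [set: 'I_a]]) = (cycle_of t x \in L)) ->
  [set image_cycle c | c in [set: pcycle s]] = L.
Proof.
move=> phiL; apply/setP => v; apply/imsetP/idP => [[c _ ->]|vL].
  by rewrite /image_cycle -phiL imset_f// inE.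
have := phiL (least v); rewrite cycle_of_least vL => /imsetP[y _ yv].
exists (cycle_of s y); first by rewrite inE.
rewrite -(cycle_of_least v) yv; apply: cycle_of_in.
by rewrite mem_image_cycle mem_cycle_of.
Qed.

End SubCycles.

Section EdgePairs.
Variables (q : nat) (m : cmap q).

Definition edge_pairs : seq ('I_(nhe m) * 'I_(nhe m)) :=
  [seq (x, eperm m x) | x <- enum 'I_(nhe m)].

Lemma mem_edge_pairs x y : ((x, y) \in edge_pairs) = (y == eperm m x).
Proof.
apply/mapP/eqP => [[z _ [-> ->]]//|->].
by exists x; rewrite ?mem_enum.
Qed.

Lemma conn_edge_pairs x y : conn edge_pairs x y = (y == x) || (y == eperm m x).
Proof.
apply/idP/idP; last first.
  move=> /orP[/eqP ->|/eqP ->]; first exact: conn_refl.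
  by apply: conn1; rewrite mem_edge_pairs.
apply: (@connect_min _ _ (fun x y => (y == x) || (y == eperm m x))).
- by move=> z; rewrite eqxx.
- move=> c d e /orP[/eqP ->//|/eqP ->] /orP[/eqP ->|/eqP ->].
    by rewrite eqxx orbT.
  by rewrite epermK eqxx.
- move=> c d /orP[|]; rewrite mem_edge_pairs => /eqP ->; first by rewrite eqxx orbT.
  by rewrite epermK eqxx orbT.
Qed.

End EdgePairs.

Lemma closed_map_eperm (m : cmap 0) x : eperm m x != x.
Proof. by have := @bdryP _ m x; rewrite tuple0 in_nil inE => <-. Qed.

Definition unNone (T : eqType) (o : option T) : o != None -> T :=
  match o with
  | Some x => fun=> x
  | None => fun h => False_rect T (elimN eqP h erefl)
  end.

Lemma unNoneK (T : eqType) (o : option T) (h : o != None) : Some (unNone h) = o.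
Proof. by case: o h. Qed.

Section FixedMap.
Variables (I0 : eqType) (ell0 : I0 -> nat) (p : nat).
Variable n : imap (ext_ell ell0 p) 0.
Local Notation H := 'I_(nhe n).
Variables (L : {set vertex n}) (E : seq (H * H)).

Definition live_halfedges : {set H} := [set x | cycle_of (vperm n) x \in L].

Hypothesis LNone : forall v, v \in L -> label v != None.
Hypothesis LE : matched live_halfedges E.

Let S := live_halfedges.

Let partner (x : H) : H := odflt x [pick y | [&& y \in S, y != x & conn E x y]].

Let partnerP x : x \in S -> [/\ partner x \in S, partner x != x, conn E x (partner x) &
  forall z, z \in S -> conn E x z -> z = x \/ z = partner x].
Proof.
move=> xS.
have /eqP/cards1P[y yE] : #|[set z in S | conn E x z] :\ x| = 1%N.
  move: (LE xS); rewrite (cardsD1 x) !inE conn_refl.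
  by move: (xS); rewrite inE => -> -[].
have yP z : (z \in [set y]) = [&& z != x, z \in S & conn E x z].
  by rewrite -yE !inE.
have /and3P[yx yS xy] : [&& y != x, y \in S & conn E x y] by rewrite -yP inE.
have py : partner x = y.
  rewrite /partner; case: pickP => [z /and3P[zS zx xz]|/(_ y)].
    by apply/eqP; have := yP z; rewrite zx zS xz inE.
  by rewrite yS yx xy.
rewrite py; split; [exact: yS|exact: yx|exact: xy|move=> z zS xz].
have := yP z; rewrite zS xz inE andbT.
by case: (eqVneq z x) => [->|_] /=; [left|move=> /eqP ->; right].
Qed.

Let vperm_live : {in S, forall x, vperm n x \in S}.
Proof. by move=> x; rewrite !inE cycle_of_perm. Qed.

Let partner_live : {in S, forall x, partner x \in S}.
Proof. by move=> x /partnerP[]. Qed.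

Let partnerK : {in S, involutive partner}.
Proof.
move=> x xS; have [yS yx xy yu] := partnerP xS.
have [zS zy yz zu] := partnerP yS.
have [//|zE] := yu _ zS (conn_trans xy yz).
by rewrite zE eqxx in zy.
Qed.

Let vfun_inj : injective (sub_fun (S := S) (vperm n)).
Proof. by apply: (sub_fun_inj vperm_live) => x y _ _; exact: perm_inj. Qed.

Let efunK : involutive (sub_fun (S := S) partner).
Proof. exact: (sub_funK partner_live partnerK). Qed.

Let efun_inj := inv_inj efunK.

Let epK : involutive (perm efun_inj).
Proof. by move=> k; rewrite !permE efunK. Qed.

Let eN : [tuple] =i [pred k | perm efun_inj k == k].
Proof.
move=> k; rewrite in_nil inE permE; apply/esym/negbTE/eqP => kE.
have [_ /eqP kN _ _] := partnerP (enum_valP k); apply: kN.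
by rewrite -(sub_funE partner_live) kE.
Qed.

Let fixed_cmap : cmap 0 := @CMap 0 #|S| (perm vfun_inj) (perm efun_inj) [tuple]
  epK isT eN.

Let phi : 'I_(nhe fixed_cmap) -> H := enum_val.

Let phi_inj : injective phi. Proof. exact: enum_val_inj. Qed.

Let phi_mono (x y : 'I_#|S|) : (x <= y)%N -> (phi x <= phi y)%N.
Proof. exact: enum_val_mono. Qed.

Let phi_perm x : phi (vperm fixed_cmap x) = vperm n (phi x).
Proof. by rewrite permE; exact: (sub_funE vperm_live). Qed.

Let f := @image_cycle _ _ (vperm fixed_cmap) (vperm n) phi.

Let fL (c : vertex fixed_cmap) : f c \in L.
Proof. by have := enum_valP (least c); rewrite inE. Qed.

Let fixed_label (c : vertex fixed_cmap) : I0 := unNone (LNone (fL c)).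

Let fixed_labelE c : Some (fixed_label c) = label (f c).
Proof. exact: unNoneK. Qed.

Let card_f (c : vertex fixed_cmap) : #|val (f c)| = #|val c|.
Proof. exact: card_image_cycle. Qed.

Let fixed_labelP (c : vertex fixed_cmap) : ell0 (fixed_label c) = #|val c|.
Proof. by rewrite -card_f -labelP -fixed_labelE. Qed.

Let fixed_imap : imap ell0 0 := IMap fixed_labelP.

Let connE x y : conn E (phi x) (phi y) = (y == x) || (y == eperm fixed_cmap x).
Proof.
have eE : phi (eperm fixed_cmap x) = partner (phi x).
  by rewrite permE; exact: (sub_funE partner_live).
have [_ _ xp xu] := partnerP (enum_valP x).
apply/idP/idP => [xy|/orP[/eqP ->|/eqP ->]]; last 2 first.
- exact: conn_refl.
- by rewrite eE.
have [/phi_inj ->|yp] := xu _ (enum_valP y) xy; first by rewrite eqxx.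
by apply/orP; right; apply/eqP/phi_inj; rewrite eE.
Qed.

Let f_onto : [set f c | c in [set: vertex fixed_cmap]] = L.
Proof.
apply: (image_cycle_onto phi_inj phi_perm) => x; apply/imsetP/idP => [[y _ ->]|xL].
  by have := enum_valP y; rewrite inE.
have xS : x \in S by rewrite inE.
by exists (enum_rank_in xS x); rewrite ?inE// /phi enum_rankK_in.
Qed.

(** Without random vertex, the live half-edges with [partner] form a map over [I0]. It is chosen
    before [N] and the tensors, so that (A1) bounds it by one constant for all N. *)
Lemma fixed_network_scalar : exists n0 : imap ell0 0,
  forall (R : realType) (N : nat) (A0 : tensor_family R N ell0)
    (W : p.-tuple 'I_N -> R), (0 < N)%N ->
  network_sum (@label _ _ _ n) (@cycle_nth _ (vperm n)) (ext_family A0 W) L E =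
  N%:R ^+ ncc (E ++ cliques (@cycle_nth _ (vperm n))
    (fun v : vertex n => ext_ell ell0 p (label v)) L) * trace_scalar A0 n0.
Proof.
exists fixed_imap => R N A0 W N0.
have nth_f (c : vertex fixed_cmap) k : cycle_nth (f c) k = phi (cycle_nth c k).
  exact: cycle_nth_image.
rewrite (@trace_scalar_network _ _ (ext_ell ell0 p) ell0 fixed_imap _ _
  (@label _ _ _ n) (@cycle_nth _ (vperm n)) R N phi f E _ connE N0
  (ext_family A0 W) A0).
- rewrite f_onto mulrA mulfV ?mul1r// expf_neq0// pnatr_eq0 -lt0n//.
- exact: image_cycle_inj.
- by move=> c; rewrite labelP card_f.
- by move=> c k _; exact: nth_f.
- move=> i c; rewrite /vertex_factor; move: (fixed_labelE c) (nth_f c).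
  rewrite /=; case: (label (f c)) => // l [<-] nth_fc.
  by congr (@A0 _ _); apply: eq_from_tnth => k; rewrite !tnth_mktuple nth_fc.
Qed.

End FixedMap.

Section PowerBounds.
Variable R : realType.
Implicit Types (F G : nat -> R[i]) (e : nat).

Definition power_bounded e F : Prop := exists2 K : R, 0 <= K &
  forall N, (0 < N)%N -> `|F N| <= K%:C * N%:R ^+ e.

Lemma power_bounded_sum (K : Type) (r : seq K) (Q : pred K) e (F : K -> nat -> R[i]) :
  (forall k, Q k -> power_bounded e (F k)) ->
  power_bounded e (fun N => \sum_(k <- r | Q k) F k N).
Proof.
move=> FB; elim: r => [|k r [K2 K20 IH]].
  by exists 0 => // N _; rewrite big_nil normr0 mul0r.
have [Qk|Qk] := boolP (Q k); last first.
  by exists K2 => // N N0; rewrite big_cons (negbTE Qk) IH.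
have [K1 K10 H1] := FB k Qk; exists (K1 + K2); first exact: addr_ge0.
move=> N N0; rewrite big_cons Qk rmorphD mulrDl.
by rewrite (le_trans (ler_normD _ _))// lerD// ?H1 ?IH.
Qed.

Lemma power_bounded_scale e e' a (z : R[i]) F : (e <= e' + a)%N ->
  power_bounded e F -> power_bounded e' (fun N => z * (N%:R ^- a * F N)).
Proof.
have zE : `|z| = (Normc.normc z)%:C by [].
have z0 : 0 <= Normc.normc z by rewrite -lecR -zE normr_ge0.
move=> ea [K K0 FK]; exists (K * Normc.normc z); first exact: mulr_ge0.
move=> N N0; have N0' : 0 < N%:R :> R[i] by rewrite ltr0n.
rewrite normrM normrM normfV normrX normr_nat.
rewrite zE rmorphM /= -mulrA [leRHS]mulrCA ler_wpM2l ?lecR//.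
rewrite mulrC ler_pdivrMr ?exprn_gt0// -mulrA -exprD.
rewrite (le_trans (FK N N0))// ler_wpM2l ?lecR// ler_weXn2l//.
by rewrite ler1n.
Qed.

End PowerBounds.

Lemma cycle_nth_inj_in n (s : {perm 'I_n}) (c : pcycle s) (j k : nat) :
  (j < #|val c|)%N -> (k < #|val c|)%N -> cycle_nth c j = cycle_nth c k -> j = k.
Proof.
rewrite cycle_leastE => jc kc.
rewrite /cycle_nth -(nth_traject s jc) -(nth_traject s kc) => /eqP.
rewrite nth_uniq ?size_traject//; first by move/eqP.
exact: uniq_traject_porbit.
Qed.

Lemma complex_expectation_cst d (T : measurableType d) (R : realType)
  (P : probability T R) (z : R[i]) : complex_expectation P (fun=> z) = z.
Proof.
rewrite /complex_expectation; case: z => x y /=.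
by rewrite !expectation_cst.
Qed.

Section ExpectedTraceNetwork.
Variables (I0 : eqType) (ell0 : I0 -> nat) (p : nat) (n : imap (ext_ell ell0 p) 0).
Variables (H V : finType) (lab : V -> option I0) (h : V -> nat -> H).
Variables (phi : 'I_(nhe n) -> H) (f : vertex n -> V) (E : seq (H * H)).
Hypothesis f_inj : injective f.
Hypothesis labE : forall v, lab (f v) = label v.
Hypothesis hE : forall (v : vertex n) k, (k < #|val v|)%N ->
  h (f v) k = phi (cycle_nth v k).
Hypothesis connE : forall x y,
  conn E (phi x) (phi y) = (y == x) || (y == eperm n x).

Lemma expected_trace_network (R : realType) (N : nat) (p0 : (0 < p)%N)
    d (T : measurableType d) (P : probability T R)
    (X : p.-tuple 'I_N -> {RV P >-> R}) (A0 : tensor_family R N ell0) :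
  gaussian_symmetric_tensor X -> (0 < N)%N ->
  expected_trace A0 X n =
  N%:R ^- ncc (E ++ cliques h (fun v => ext_ell ell0 p (lab v))
    [set f v | v in [set: vertex n]]) *
  network_expectation X A0 lab h [set f v | v in [set: vertex n]] E.
Proof.
move=> hX N0; rewrite -complex_expectationZ_network//.
congr complex_expectation; apply/funext => w.
apply: (trace_scalar_network f_inj connE N0).
- by move=> v; rewrite labE labelP.
- exact: hE.
- move=> i v; rewrite /vertex_factor labE; congr (ext_family _ _ _).
  apply: eq_from_tnth => k; rewrite !tnth_mktuple hE//.
  by rewrite -labelP.
Qed.

End ExpectedTraceNetwork.

(** The tail of [l] is treated first; by uniqueness [a] and [b] are then still in the remaining set,
    as [matched_cons] requires. *)
Lemma matched_cat (H : finType) (D : {set H}) (E l : seq (H * H)) :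
  uniq (map fst l ++ map snd l) -> {subset map fst l ++ map snd l <= D} ->
  matched D E -> matched (D :\: [set x in map fst l ++ map snd l]) (l ++ E).
Proof.
move=> + + DE; elim: l => [_ _|[a b] l IH] /=.
  by rewrite (_ : [set x in [::]] = finset.set0) ?finset.setD0.
set r := map fst l; set t := map snd l.
have mem x : x \in r ++ b :: t = (x == b) || (x \in r ++ t).
  by rewrite !mem_cat inE orbCA.
move=> /andP[]; rewrite mem negb_or => /andP[ab art].
rewrite uniq_catC /= mem_cat orbC -mem_cat => /andP[brt]; rewrite uniq_catC => urt sub.
have DEl : matched (D :\: [set x in r ++ t]) (l ++ E).
  by apply: IH => // x xl; apply: sub; rewrite inE mem xl !orbT.
have -> : D :\: [set x in a :: r ++ b :: t] = (D :\: [set x in r ++ t]) :\ a :\ b.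
  apply/setP => x; rewrite !inE mem !negb_or -!andbA.
  by case: (x != a); case: (x != b); rewrite ?andbF.
apply: matched_cons => //.
- by rewrite !inE art sub// mem_head.
- by rewrite !inE brt sub// inE mem eqxx orbT.
Qed.

Section ExpectedTraceBound.
Variables (R : realType) (p : nat) (p0 : (0 < p)%N).
Variables (d : nat -> measure_display) (T : forall N : nat, measurableType (d N)).
Variables (P : forall N : nat, probability (T N) R).
Variable X : forall N : nat, p.-tuple 'I_N -> {RV (P N) >-> R}.
Hypothesis hX : forall N : nat, (0 < N)%N -> gaussian_symmetric_tensor (@X N).
Variables (I0 : eqType) (ell0 : I0 -> nat).
Variable A0 : forall N : nat, tensor_family R N ell0.
Hypothesis hA1 : forall n : imap ell0 0, exists K : R, forall N : nat, (0 < N)%N ->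
  `|trace_scalar (@A0 N) n| <= K%:C.
Variable n : imap (ext_ell ell0 p) 0.

Let h (v : vertex n) (k : nat) := cycle_nth v k.
Let lab (v : vertex n) := label v.
Let deg (v : vertex n) := ext_ell ell0 p (lab v).

Let degE v : deg v = #|val v|. Proof. by rewrite /deg labelP. Qed.

Let mem_glue1 u v (sigma : 'S_p) x : deg u = p ->
  (x \in map fst (glue h u v sigma)) = (cycle_of (vperm n) x == u).
Proof.
move=> du; rewrite -map_comp; apply/mapP/eqP => [[k _ ->]|xu].
  by apply: cycle_of_in; exact: cycle_nth_in.
have xin : x \in val u by rewrite -xu mem_cycle_of.
have [k + <-] := cycle_nth_ex xin; rewrite -degE du => kp.
by exists (sigma^-1 (Ordinal kp))%g; rewrite ?mem_enum//= permKV.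
Qed.

Let mem_glue2 u v (sigma : 'S_p) x : deg v = p ->
  (x \in map snd (glue h u v sigma)) = (cycle_of (vperm n) x == v).
Proof.
move=> dv; rewrite -map_comp; apply/mapP/eqP => [[k _ ->]|xv].
  by apply: cycle_of_in; exact: cycle_nth_in.
have xin : x \in val v by rewrite -xv mem_cycle_of.
have [k + <-] := cycle_nth_ex xin; rewrite -degE dv => kp.
by exists (Ordinal kp); rewrite ?mem_enum.
Qed.

Let h_inj v : deg v = p -> injective (fun k : 'I_p => h v k).
Proof.
by move=> dv j k /cycle_nth_inj_in jk; apply/val_inj/jk; rewrite -degE dv.
Qed.

Let uniq_glue u v (sigma : 'S_p) : v != u -> deg u = p -> deg v = p ->
  uniq (map fst (glue h u v sigma) ++ map snd (glue h u v sigma)).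
Proof.
move=> vu du dv; rewrite cat_uniq; apply/and3P; split.
- rewrite -map_comp map_inj_uniq ?enum_uniq// => j k /= /(h_inj du) /perm_inj.
  exact.
- apply/hasPn => x; rewrite mem_glue2// => /eqP xv.
  by rewrite mem_glue1// xv.
- by rewrite -map_comp map_inj_uniq ?enum_uniq// => j k /= /(h_inj dv).
Qed.

(** Induction on the number of random vertices. The exponent is chosen to be stable: contracting [u]
    and [v] divides by N^(p-1), and by [ncc_glue] the number of classes grows by at most p-1. A
    single random vertex leaves an empty sum. *)
Lemma network_bounded L E : matched (live_halfedges L) E ->
  power_bounded (ncc (E ++ cliques h deg L))
    (fun N => network_expectation (@X N) (@A0 N) lab h L E).
Proof.
have [s] := ubnP #|random_vertices lab L|; elim: s L E => // s IH L E.
rewrite ltnS => Ls LE.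
have [r0|] := eqVneq (random_vertices lab L) finset.set0.
  have LN v : v \in L -> label v != None.
    move=> vL; apply/negP => vN; suff: v \in random_vertices lab L by rewrite r0 inE.
    by rewrite inE vL.
  have [n0 nE] := fixed_network_scalar LN LE.
  have [K KE] := hA1 n0; exists `|K| => // N N0.
  (* The network is now deterministic, so the expectation is that of a constant. *)
  rewrite /network_expectation.
  under [X in complex_expectation _ X]funext do rewrite nE//.
  rewrite complex_expectation_cst normrM mulrC normrX normr_nat ler_wpM2r ?exprn_ge0//.
  by rewrite (le_trans (KE N N0))// lecR ler_norm.
move=> /set0Pn[u]; rewrite inE => /andP[uL /eqP uN].
have B v (sigma : 'S_p) : v \in random_vertices lab L :\ u ->
  power_bounded (ncc (E ++ cliques h deg L))
    (fun N => ((p.-1)`!%:R)^-1 * (N%:R ^- p.-1 *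
      network_expectation (@X N) (@A0 N) lab h (L :\ u :\ v)
        (glue h u v sigma ++ E))).
  rewrite !inE => /and3P[vu vL /eqP vN].
  have du : deg u = p by rewrite /deg uN.
  have dv : deg v = p by rewrite /deg vN.
  apply: power_bounded_scale (ncc_glue h L sigma E p0 du dv) _.
  apply: IH.
    rewrite (leq_trans _ Ls)//; apply: proper_card; apply/properP; split.
      by apply/fintype.subsetP => x; rewrite !inE => /andP[/and3P[_ _ ->]].
    by exists u; rewrite !inE ?uL ?uN// eqxx andbF.
  have -> : live_halfedges (L :\ u :\ v) = live_halfedges L :\:
      [set x in map fst (glue h u v sigma) ++ map snd (glue h u v sigma)].
    apply/setP => x; rewrite !inE mem_cat mem_glue1// mem_glue2//.
    by rewrite negb_or -andbA andbCA.
  apply: matched_cat => //; first exact: uniq_glue.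
  move=> x; rewrite mem_cat mem_glue1// mem_glue2// inE.
  by move=> /orP[/eqP ->|/eqP ->].
have {}B := power_bounded_sum (index_enum _) (fun v vr =>
  power_bounded_sum (index_enum _) (fun sigma (_ : true) => B v sigma vr)).
have [K K0 KE] := B; exists K => // N N0.
rewrite (network_expectation_rec p0 (hX N0) (@A0 N) h E N0 uL uN) 2!mulr_sumr.
apply: le_trans (KE N N0); rewrite le_eqVlt; apply/orP; left; apply/eqP; congr `|_|.
by apply: eq_bigr => v _; rewrite 2!mulr_sumr.
Qed.

(** For the network of all vertices and edges, the exponent in [network_bounded] is the one by which
    the trace is normalized; the edges match all half-edges since a closed map has no boundary. *)
Lemma expected_trace_bounded :
  power_bounded 0 (fun N => expected_trace (@A0 N) (@X N) n).
Proof.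
have [|K K0 KE] := @network_bounded [set: vertex n] (edge_pairs n).
  move=> x _; rewrite (_ : [set z in _ | _] = [set x; eperm n x]).
    by rewrite cards2 eq_sym closed_map_eperm.
  by apply/setP => z; rewrite !inE conn_edge_pairs.
exists K => // N N0; rewrite expr0 mulr1.
have LT : [set v | v in [set: vertex n]] = [set: vertex n].
  by apply/setP => v; rewrite inE; apply/imsetP; exists v; rewrite ?inE.
rewrite (@expected_trace_network _ _ _ _ _ _ lab h id id (edge_pairs n)) //;
  last 2 first.
- exact: conn_edge_pairs.
- exact: hX.
rewrite LT normrM normfV normrX normr_nat mulrC ler_pdivrMr.
  exact: KE.
by rewrite exprn_gt0// ltr0n.
Qed.

End ExpectedTraceBound.

(** * Adding and deleting a vertex *)

(* The vertex [None] stands for the vertex added to [m]: its legs are put at the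
   boundary edges themselves, so that no half-edge has to be added. *)
Section BoundaryNetwork.
Variables (I0 : eqType) (ell0 : I0 -> nat) (p : nat) (p0 : (0 < p)%N).
Variable m : imap (ext_ell ell0 p) p.
Local Notation H := 'I_(nhe m).
Local Notation V := (option (vertex m)).

Let k0 : 'I_p := Ordinal p0.

Definition bdry_label (v : V) : option I0 := if v is Some c then label c else None.

Definition bdry_halfedge (v : V) (k : nat) : H :=
  if v is Some c then cycle_nth c k else nth (tnth (bdry m) k0) (bdry m) k.

Let h := bdry_halfedge.
Let lab := bdry_label.
Let deg v := ext_ell ell0 p (lab v).
Let bd k : H := tnth (bdry m) k.

Let h_None (k : 'I_p) : h None k = bd k.
Proof. by rewrite /h /= /bd -tnth_nth. Qed.

Let bd_inj : injective bd. Proof. exact: tnth_bdry_inj. Qed.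

Let bd_fixed k : eperm m (bd k) = bd k.
Proof. by apply/eqP; have := mem_tnth k (bdry m); rewrite bdryP inE. Qed.

Let n := add_vertex None m.

Let phi (x : 'I_(nhe n)) : H :=
  match @fintype.split (nhe m) p x with inl y => y | inr k => bd k end.

Let phil y : phi (lshift p y) = y. Proof. by rewrite /phi (unsplitK (inl y)). Qed.

Let phir k : phi (rshift (nhe m) k) = bd k.
Proof. by rewrite /phi (unsplitK (inr k)). Qed.

Let f (v : vertex n) : V :=
  match @fintype.split (nhe m) p (least v) with
  | inl y => Some (cycle_of (vperm m) y)
  | inr _ => None
  end.

Let lperm x : lshift p (vperm m x) = vperm n (lshift p x).
Proof. by rewrite permE /add_vfun (unsplitK (inl x)). Qed.

Let rot : {perm 'I_p} := perm (@ordS_inj p).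

Let rperm k : rshift (nhe m) (rot k) = vperm n (rshift (nhe m) k).
Proof. by rewrite !permE /add_vfun (unsplitK (inr k)). Qed.

Let old (c : vertex m) : vertex n := @image_cycle _ _ (vperm m) (vperm n) (lshift p) c.

Let new : vertex n :=
  @image_cycle _ _ rot (vperm n) (@rshift (nhe m) p) (cycle_of rot k0).

Let lmono (x y : 'I_(nhe m)) : (x <= y)%N -> (lshift p x <= lshift p y)%N.
Proof. by []. Qed.

Let rmono (x y : 'I_p) : (x <= y)%N -> (rshift (nhe m) x <= rshift (nhe m) y)%N.
Proof. by rewrite /= leq_add2l. Qed.

Let linj : injective (@lshift (nhe m) p). Proof. exact: lshift_inj. Qed.
Let rinj : injective (@rshift (nhe m) p). Proof. exact: rshift_inj. Qed.

Let rot_cycle k : k \in val (cycle_of rot k0).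
Proof.
suff -> : val (cycle_of rot k0) = [set: 'I_p] by rewrite inE.
apply/eqP; rewrite eqEcard finset.subsetT cardsT card_ord /=.
by rewrite card_porbit_ordS.
Qed.

Let least_rot : least (cycle_of rot k0) = k0.
Proof.
by apply: val_inj; apply/eqP; rewrite -leqn0; apply: (least_min (rot_cycle k0)).
Qed.

Let rot_nth (k : nat) : (k < p)%N -> cycle_nth (cycle_of rot k0) k = k :> nat.
Proof.
rewrite /cycle_nth least_rot; elim: k => // k IH kp.
by rewrite iterS permE /= IH ?modn_small// ltnW.
Qed.

Let vertex_cases (v : vertex n) : (exists c, v = old c) \/ v = new.
Proof.
rewrite -(cycle_of_least v); case: (fintype.split_ordP (least v)) => [y ->|k ->].
  left; exists (cycle_of (vperm m) y); apply: cycle_of_in.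
  by rewrite (mem_image_cycle linj lperm) mem_cycle_of.
by right; apply: cycle_of_in; rewrite (mem_image_cycle rinj rperm).
Qed.

Let least_old c : least (old c) = lshift p (least c).
Proof. exact: least_image_cycle. Qed.

Let least_new : least new = rshift (nhe m) k0.
Proof. by rewrite (least_image_cycle rinj rmono rperm) least_rot. Qed.

Let f_old c : f (old c) = Some c.
Proof. by rewrite /f least_old (unsplitK (inl _)) cycle_of_least. Qed.

Let f_new : f new = None.
Proof. by rewrite /f least_new (unsplitK (inr _)). Qed.

Let f_inj : injective f.
Proof.
move=> v v'; case: (vertex_cases v) => [[c ->]| ->];
  case: (vertex_cases v') => [[c' ->]| ->]; rewrite ?f_old ?f_new //.
by move=> [->].
Qed.

Let f_onto : [set f v | v in [set: vertex n]] = [set: V].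
Proof.
apply/setP => -[c|]; rewrite inE; apply/imsetP.
  by exists (old c); rewrite ?inE ?f_old.
by exists new; rewrite ?inE ?f_new.
Qed.

Let labE v : lab (f v) = label v.
Proof.
case: (vertex_cases v) => [[c ->]| ->]; rewrite ?f_old ?f_new /=.
  by rewrite /add_label least_old (unsplitK (inl _)) cycle_of_least.
by rewrite /add_label least_new (unsplitK (inr _)).
Qed.

Let hE (v : vertex n) k : (k < #|val v|)%N -> h (f v) k = phi (cycle_nth v k).
Proof.
rewrite -labelP -labE.
case: (vertex_cases v) => [[c ->]| ->]; rewrite ?f_old ?f_new /= => kv.
  by rewrite /old (cycle_nth_image linj lmono lperm) phil.
rewrite /new (cycle_nth_image rinj rmono rperm) phir -h_None /=.
by rewrite rot_nth.
Qed.

(** A boundary edge is a fixed point of [eperm m]; in [n] it becomes an edge whose two ends [phi]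
    sends to this point. Other edges are unchanged. *)
Let connE x y : conn (edge_pairs m) (phi x) (phi y) = (y == x) || (y == eperm n x).
Proof.
rewrite conn_edge_pairs permE /add_efun.
have fixed a : eperm m a = a -> exists k, bd k = a.
  move=> /eqP af; have /tnthP[k ->] : a \in bdry m by rewrite bdryP inE.
  by exists k.
case: (fintype.split_ordP x) => [a ->|k ->];
  case: (fintype.split_ordP y) => [b ->|j ->];
  rewrite ?phil ?phir ?(unsplitK (inl _)) ?(unsplitK (inr _)).
- rewrite eq_lshift; case: pickP => [k /eqP <-|aN]; last by rewrite eq_lshift.
  by rewrite eq_lrshift orbF bd_fixed orbb.
- rewrite eq_rlshift /=; case: pickP => [k /eqP <-|aN].
    by rewrite bd_fixed orbb eq_rshift (inj_eq bd_inj).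
  rewrite eq_rlshift [X in X || _]aN /=; apply/negbTE/eqP => ja.
  have := aN j; rewrite -[X in _ == X](epermK (c := m)) -ja => /eqP; apply.
  by rewrite -/(bd j) bd_fixed.
- by rewrite eq_lrshift /= eq_lshift bd_fixed orbb.
- by rewrite eq_rshift eq_rlshift bd_fixed orbb orbF (inj_eq bd_inj).
Qed.

(** The connectedness of [m] gives at most one class, and the point [bd k0], available since p > 0,
    gives at least one. Hence the single factor 1/N in front of the trace. *)
Let ncc_boundary_network : connected_map m ->
  ncc (edge_pairs m ++ cliques h deg [set: V]) = 1%N.
Proof.
move=> /eqP m1; set E1 := _ ++ _.
have vp x : conn E1 x (vperm m x).
  have cl y (c : vertex m) : y \in val c -> conn E1 (h (Some c) 0) y.
    move=> /cycle_nth_ex[k kc <-]; apply: conn1; rewrite mem_cat; apply/orP; right.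
    apply/cliquesP; exists (Some c); rewrite ?inE//.
    by exists k; rewrite // /deg /= labelP.
  apply: (conn_trans (y := h (Some (cycle_of (vperm m) x)) 0)).
    by rewrite connC; apply: cl; exact: mem_cycle_of.
  by apply: cl; rewrite -cycle_of_perm; exact: mem_cycle_of.
have adjE : subrel (connect (@Defs.adjacent _ m)) (conn E1).
  apply: connect_min; [exact: conn_refl|exact: conn_trans|].
  move=> x y /or3P[/eqP ->|/eqP ->|/eqP ->]; first exact: vp.
    by rewrite connC; exact: vp.
  by apply: conn1; rewrite mem_cat mem_edge_pairs eqxx.
apply/eqP; rewrite eqn_leq; apply/andP; split.
  rewrite -m1; apply: leq_card_kernel => x y _ _.
  by move=> /(class_eqP (@adjacent_sym _ m))/adjE/(class_eqP (conn_sym E1)).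
apply/fintype.card_gt0P; exists [set z | connect (pair_rel E1) (bd k0) z].
by apply: imset_f; rewrite inE.
Qed.

Lemma expected_trace_add_vertex (R : realType) (N : nat) d (T : measurableType d)
    (P : probability T R) (X : p.-tuple 'I_N -> {RV P >-> R})
    (A0 : tensor_family R N ell0) :
  connected_map m -> gaussian_symmetric_tensor X -> (0 < N)%N ->
  expected_trace A0 X (add_vertex None m) =
  N%:R^-1 * network_expectation X A0 lab h [set: V] (edge_pairs m).
Proof.
move=> mc hX N0; rewrite (expected_trace_network f_inj labE hE connE p0 A0 hX N0).
by rewrite f_onto ncc_boundary_network// expr1.
Qed.

Section DeletedVertex.
Variables (v : labelled_vertex None m) (sigma : 'S_p).
Let m' := permute_bdry m sigma.
Let hv : #|val (val v)| = p := labelled_vertex_card v.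
Let n' := delete None m' v.
Let S : {set H} := ~: val (val v).

Let E : seq (H * H) := glue h None (Some (val v)) sigma ++ edge_pairs m.

Let glue_connE : connect (@glue_graph _ _ _ m' (val v)) =2 conn E.
Proof.
have gE (j : 'I_p) : conn E (cycle_nth (val v) j) (bd (sigma j)).
  rewrite connC; apply: conn1; rewrite mem_cat; apply/orP; left.
  by apply/mapP; exists j; rewrite ?mem_enum// h_None.
have bE (j : 'I_p) : tnth (bdry m') j = bd (sigma j) by rewrite tnth_mktuple.
have gsym : connect_sym (@glue_graph _ _ _ m' (val v)).
  by apply: sym_connect_sym; exact: glue_graph_sym.
move=> x y; apply/idP/idP; move: x y.
  apply: connect_min; [exact: conn_refl|exact: conn_trans|].
  move=> x y /or3P[/andP[_ /eqP ->]|/existsP[j /andP[/eqP -> /eqP ->]]|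
    /existsP[j /andP[/eqP -> /eqP ->]]].
  - by apply: conn1; rewrite mem_cat mem_edge_pairs eqxx orbT.
  - by rewrite bE; exact: gE.
  - by rewrite bE connC; exact: gE.
have h1 x y : (x, y) \in E -> connect (@glue_graph _ _ _ m' (val v)) x y.
  rewrite mem_cat mem_edge_pairs => /orP[/mapP[j _ [-> ->]]|/eqP ->].
    apply: connect1; apply/or3P; apply: Or33; apply/existsP; exists j.
    by rewrite eqxx bE /bd [X in _ == X](tnth_nth (tnth (bdry m) k0)) eqxx.
  have [xx|xx] := eqVneq x (eperm m x); first by rewrite -xx connect0.
  by apply: connect1; apply/or3P; apply: Or31; rewrite xx /=.
apply: connect_sub => x y /orP[/h1 //|/h1].
by rewrite gsym.
Qed.

Let dphi : 'I_(nhe n') -> H := enum_val.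

Let dphi_inj : injective dphi. Proof. exact: enum_val_inj. Qed.

Let dphi_mono (x y : 'I_#|S|) : (x <= y)%N -> (dphi x <= dphi y)%N.
Proof. exact: enum_val_mono. Qed.

Let dphi_perm x : dphi (vperm n' x) = vperm m (dphi x).
Proof. by rewrite permE; exact: (sub_funE (@vperm_in _ _ _ m' (val v))). Qed.

Let dv := @image_cycle _ _ (vperm n') (vperm m) dphi.

Let df (w : vertex n') : V := Some (dv w).

Let df_inj : injective df.
Proof. exact: (inj_comp (@Some_inj _) (image_cycle_inj dphi_inj dphi_perm)). Qed.

Let df_onto : [set df w | w in [set: vertex n']] = [set: V] :\ None :\ Some (val v).
Proof.
have onto : [set dv w | w in [set: vertex n']] = [set~ val v].
  apply: (image_cycle_onto dphi_inj dphi_perm) => x.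
  have -> : (cycle_of (vperm m) x \in [set~ val v]) = (x \in S).
    rewrite !inE; congr (~~ _); apply/eqP/idP => [<-|]; first exact: mem_cycle_of.
    exact: cycle_of_in.
  apply/imsetP/idP => [[y _ ->]|xS]; first exact: enum_valP.
  by exists (enum_rank_in xS x); rewrite ?inE// /dphi enum_rankK_in.
rewrite /df (imset_comp Some) onto; apply/setP => -[c|]; rewrite !inE.
  by rewrite mem_imset ?inE ?andbT//; exact: Some_inj.
by rewrite andbF; apply/imsetP => -[].
Qed.

Let dlabE w : lab (df w) = label w. Proof. by []. Qed.

Let dhE (w : vertex n') k : (k < #|val w|)%N -> h (df w) k = dphi (cycle_nth w k).
Proof. by move=> _; exact: cycle_nth_image. Qed.

(** By [glue_graph_ends], the class of a half-edge not attached to [v] contains exactly one other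
    such half-edge, which is [other_end]. *)
Let dconnE x y : conn E (dphi x) (dphi y) = (y == x) || (y == eperm n' x).
Proof.
have eE : dphi (eperm n' x) = @other_end _ _ _ m' (val v) (dphi x).
  by rewrite permE; exact: (sub_funE (@other_end_in _ _ _ m' (val v) hv)).
have xS : dphi x \in S by exact: enum_valP.
have yS : dphi y \in S by exact: enum_valP.
have [oS ox xo] := @other_endP _ _ _ m' (val v) hv _ xS.
rewrite -glue_connE.
apply/idP/idP => [xy|/orP[/eqP ->|/eqP ->]]; last 2 first.
- exact: connect0.
- by rewrite eE.
move: xS yS oS; rewrite !inE => xv yv ov.
have [z _ zu] := @glue_graph_ends _ _ _ m' (val v) hv _ xv.
have [/dphi_inj ->|yz] := zu _ yv xy; first by rewrite eqxx.
have [oE|oz] := zu _ ov xo; first by rewrite oE eqxx in ox.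
by apply/orP; right; apply/eqP/dphi_inj; rewrite eE oz.
Qed.

Let nfreeE : nfree dphi E = ncircles (m := m') (val v).
Proof.
have cE : components (pair_rel E) = components (@glue_graph _ _ _ m' (val v)).
  apply: eq_imset => x; apply/setP => y; rewrite !inE.
  exact/esym/glue_connE.
rewrite /nfree cE; apply: eq_card => C; rewrite !inE; congr (_ && _).
apply/forallP/fintype.subsetP => [CS x xC|CS x].
  apply: contraT => xv; have xS : x \in S by rewrite inE.
  by have := CS (enum_rank_in xS x); rewrite /dphi enum_rankK_in// xC.
by apply/negP => /CS xv; have := enum_valP x; rewrite inE xv.
Qed.

Lemma delete_ncompE : delete_ncomp None m' v =
  ncc (E ++ cliques h deg ([set: V] :\ None :\ Some (val v))).
Proof.
rewrite -df_onto (ncc_map_network _ dhE dconnE) ?nfreeE//.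
by move=> w; rewrite /deg dlabE labelP.
Qed.

Lemma expected_trace_delete (R : realType) (N : nat) d (T : measurableType d)
    (P : probability T R) (X : p.-tuple 'I_N -> {RV P >-> R})
    (A0 : tensor_family R N ell0) :
  gaussian_symmetric_tensor X -> (0 < N)%N ->
  network_expectation X A0 lab h ([set: V] :\ None :\ Some (val v)) E =
  N%:R ^+ delete_ncomp None m' v * expected_trace A0 X (delete None m' v).
Proof.
move=> hX N0; rewrite (expected_trace_network df_inj dlabE dhE dconnE p0 A0 hX N0).
rewrite delete_ncompE df_onto mulrA mulfV ?mul1r//.
by rewrite expf_neq0// pnatr_eq0 -lt0n.
Qed.

(** The map with the vertex added has one class, and gluing adds at most p-1. *)
Lemma delete_ncomp_le : connected_map m -> (delete_ncomp None m' v <= p)%N.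
Proof.
move=> mc; rewrite delete_ncompE.
have dS : deg (Some (val v)) = p by rewrite /deg /lab /= (eqP (valP v)).
apply: (leq_trans (ncc_glue h [set: V] sigma (edge_pairs m) p0
  (erefl : deg None = p) dS)).
by rewrite ncc_boundary_network// add1n prednK.
Qed.

End DeletedVertex.

(** The powers of N are N^-1 from the normalization of the connected map, N^-(p-1) from the
    covariance and N^c from [expected_trace_delete]. As c <= p, they combine into the inverse of a
    natural power. *)
Lemma expected_trace_add_vertex_expansion (R : realType) (N : nat)
    d (T : measurableType d) (P : probability T R) (X : p.-tuple 'I_N -> {RV P >-> R})
    (A0 : tensor_family R N ell0) :
  connected_map m -> gaussian_symmetric_tensor X -> (0 < N)%N ->
  expected_trace A0 X (add_vertex None m) = ((p.-1)`!%:R)^-1 *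
    \sum_(v : labelled_vertex None m) \sum_(sigma : 'S_p)
      N%:R ^- (p - delete_ncomp None (permute_bdry m sigma) v) *
      expected_trace A0 X (delete None (permute_bdry m sigma) v).
Proof.
move=> mc hX N0; rewrite expected_trace_add_vertex//.
rewrite (network_expectation_rec p0 hX A0 h _ N0 (u := None)) ?inE//.
rewrite mulrCA; congr (_ * _); rewrite mulrA -invfM -exprS prednK//.
have N1 : N%:R != 0 :> R[i] by rewrite pnatr_eq0 -lt0n.
have vE : random_vertices lab [set: V] :\ None =
    [set Some (val v) | v in [set: labelled_vertex None m]].
  apply/setP => -[c|]; rewrite !inE /=; last by apply/esym/imsetP => -[].
  apply/idP/imsetP => [cN|[v _ [->]]]; last exact: (valP v).
  by exists (exist _ c cN); rewrite ?inE.
rewrite vE big_imset /=; last by move=> v w _ _ [/val_inj].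
rewrite mulr_sumr; apply: eq_big => [v|v _]; first by rewrite inE.
rewrite mulr_sumr; apply: eq_bigr => sigma _.
rewrite expected_trace_delete// mulrA; congr (_ * _).
have le := delete_ncomp_le v sigma mc.
set k := delete_ncomp _ _ _ in le *.
have -> : N%:R ^+ p = N%:R ^+ (p - k) * N%:R ^+ k :> R[i] by rewrite -exprD subnK.
by rewrite invfM -mulrA mulVf ?mulr1// expf_neq0.
Qed.

End BoundaryNetwork.

(** * From the exact expansion to the error term *)

Local Open Scope classical_set_scope.

Theorem proposition1 (R : realType) (p : nat) (hp : (0 < p)%N)
    (d : nat -> measure_display) (T : forall N : nat, measurableType (d N))
    (P : forall N : nat, probability (T N) R)
    (X : forall N : nat, p.-tuple 'I_N -> {RV (P N) >-> R})
    (hX : forall N : nat, (0 < N)%N -> gaussian_symmetric_tensor (X N))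
    (I0 : finType) (ell0 : I0 -> nat)
    (A0 : forall N : nat, tensor_family R N ell0)
    (hconj : forall N : nat, (0 < N)%N -> conj_stable (A0 N))
    (hA1 : forall n : imap ell0 0, exists K : R, forall N : nat, (0 < N)%N ->
       `|trace_scalar (A0 N) n| <= K%:C)
    (m : imap (ext_ell ell0 p) p) (hm : connected_map m) :
  (fun N : nat =>
     expected_trace (A0 N) (X N) (add_vertex None m) : R[i]^o) =
  (fun N : nat =>
     ((p.-1)`!%:R)^-1 *
     \sum_(v : labelled_vertex None m)
       \sum_(sigma : 'S_p |
             delete_ncomp None (permute_bdry m sigma) v == p)
         expected_trace (A0 N) (X N)
           (delete None (permute_bdry m sigma) v) : R[i]^o)
  +O_\oo (fun N : nat => N%:R^-1 : R[i]^o).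
Proof.
pose ET N (v : labelled_vertex None m) (sigma : 'S_p) :=
  expected_trace (A0 N) (X N) (delete None (permute_bdry m sigma) v).
pose cc (v : labelled_vertex None m) (sigma : 'S_p) :=
  delete_ncomp None (permute_bdry m sigma) v.
have le v sigma : (cc v sigma <= p)%N by exact: delete_ncomp_le.
(* The error multiplied by N: a term with c < p has weight N^-(p-c), from which one factor 1/N is
   taken out, whence the predecessor in the exponent. *)
have [K K0 KE] : power_bounded 0 (fun N => \sum_(v : labelled_vertex None m)
    \sum_(sigma : 'S_p | cc v sigma != p)
      ((p.-1)`!%:R)^-1 * (N%:R ^- (p - cc v sigma).-1 * ET N v sigma)).
  apply: power_bounded_sum => v _; apply: power_bounded_sum => sigma _.
  apply: (@power_bounded_scale _ 0 0) => //.
  exact: (expected_trace_bounded hp hX hA1).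
(* The constant must be positive, and [K] may be 0. *)
apply/eqaddOP/bigO_exP; exists (K%:C + 1).
  by rewrite ltr_wpDl// lecR.
near=> N; have N0 : (0 < N)%N by near: N; exact: nbhs_infty_gt.
have N1 : N%:R != 0 :> R[i] by rewrite pnatr_eq0 -lt0n.
rewrite !fctE /= (expected_trace_add_vertex_expansion hp (A0 N) hm (hX N N0) N0).
rewrite [X in `|X|](_ : _ = N%:R^-1 * \sum_(v : labelled_vertex None m)
    \sum_(sigma : 'S_p | cc v sigma != p)
      ((p.-1)`!%:R)^-1 * (N%:R ^- (p - cc v sigma).-1 * ET N v sigma)).
  rewrite normrM mulrC ler_wpM2r// (le_trans (KE N N0))// expr0 mulr1.
  by rewrite lerDl.
rewrite -mulrBr -sumrB !mulr_sumr; apply: eq_bigr => v _.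
(* Terms with exactly p components have weight 1 and cancel with the main sum; the others are the
   error. *)
rewrite (bigID (fun sigma => cc v sigma == p))/= !mulrDr addrAC.
rewrite [X in X + _ = _](_ : _ = 0) ?add0r.
  rewrite !mulr_sumr; apply: eq_bigr => sigma sp.
  have lt : (0 < p - cc v sigma)%N by rewrite subn_gt0 ltn_neqAle sp le.
  by rewrite [RHS]mulrCA; congr (_ * _); rewrite [RHS]mulrA -invfM -exprS prednK.
rewrite mulrN; apply/eqP; rewrite subr_eq0; apply/eqP; congr (_ * _).
apply: eq_bigr => sigma /eqP sp.
by rewrite -/(cc v sigma) sp subnn expr0 invr1 mul1r.
Unshelve. all: by end_near. Qed.
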